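(* Let $\mathcal{A}\in\mathcal{H}(s_{i,j})$ be a complete hypertetrahedral arrangement in $\mathbb{P}^n$ and let $X\in L(\mathcal{A})$ be a (nonempty) linear subspace. Then: (i) $\pi(\mathcal{A}_X)\cong \pi(\mathcal{A}_{W_X})\times \mathcal{A}_{\Gamma_X}$. (ii) $\mathcal{A}_X$ is free if and only if $\pi(\mathcal{A}_{W_X})$ is free and the graph $\Gamma_X$ is chordal.
   Context: $\Bbbk$ is an algebraically closed field of characteristic $0$, $R=\Bbbk[x_0,\dots,x_n]$, $\mathbb{P}^n=\mathrm{Proj}(R)$. A hyperplane arrangement $\mathcal{A}$ is a finite (possibly empty) set of distinct hyperplanes in $\mathbb{P}^n$; $f_{\mathcal{A}}$ denotes the product of linear forms defining its hyperplanes ($f=1$ for the empty arrangement). $\mathrm{Der}(-\log\mathcal{A})=\{\theta\in \mathrm{Der}_{\Bbbk}(R): \theta(f_{\mathcal{A}})\in (f_{\mathcal{A}})\}$; $\mathcal{A}$ is free if $\mathrm{Der}(-\log\mathcal{A})$ is a free $R$-module (of rank $n+1$). Two arrangements are isomorphic ($\cong$) if an invertible linear change of coordinates carries one to the other. For $0\le i<j\le n$ let $\mathcal{L}_{i,j}=\{x_i=x_j=0\}$. A hypertetrahedral arrangement in $\mathbb{P}^n$ is one in which every hyperplane contains some $\mathcal{L}_{i,j}$; it is complete if it contains all coordinate hyperplanes $H_i=\{x_i=0\}$, $0\le i\le n$. For integers $s_{i,j}\ge 1$ ($0\le i<j\le n$), $\mathcal{H}(s_{i,j})$ is the set of complete hypertetrahedral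 arrangements with exactly $s_{i,j}+2$ hyperplanes through $\mathcal{L}_{i,j}$ for all $i<j$. So $\mathcal{A}\in\mathcal{H}(s_{i,j})$ consists of the coordinate hyperplanes and, for each $i<j$, of $s_{i,j}$ distinct ''inner'' hyperplanes $\{a x_i+b x_j=0\}$ with $a,b\ne 0$. $L(\mathcal{A})$ is the set of intersections of nonempty subcollections of hyperplanes of $\mathcal{A}$ (only nonempty linear subspaces of $\mathbb{P}^n$ are considered). For $X\in L(\mathcal{A})$, $\mathcal{A}_X=\{H\in\mathcal{A}: X\subset H\}$. Supports: an inner hyperplane $\{ax_i+bx_j=0\}$ has support $\{x_i,x_j\}$, the hyperplane $\{x_i=0\}$ has support $\{x_i\}$, and the support of a subarrangement $\mathcal{B}\subset\mathcal{A}$ is the union of the supports of its hyperplanes. If $\mathrm{supp}(\mathcal{B})=\{x_{i_0},\dots,x_{i_k}\}$, then $\pi(\mathcal{B})$ is the arrangement in $\mathbb{P}^k=\mathrm{Proj}\,\Bbbk[x_{i_0},\dots,x_{i_k}]$ defined by the same linear forms as $\mathcal{B}$. $W_X$ is the intersection of all coordinate hyperplanes containing $X$ (the smallest-dimensional intersection of coordinate hyperplanes containing $X$); if $X$ lies in no coordinate hyperplane, $X$ is called inner, $W_X:=\emptyset$, and $\mathcal{A}_{W_X}$ is the empty arrangement. Graph $\Gamma_X$: let $\mathcal{A}_X-\mathcal{A}_{W_X}$ denote set difference. If it is nonempty with support $\{x_{i_0},\dots,x_{i_k}\}$, then $\Gamma_X$ is the graph with vertex set $\{i_0,\dots,i_k\}$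 and with an edge $(i_l,i_m)$ whenever some $H\in\mathcal{A}_X-\mathcal{A}_{W_X}$ has support $\{x_{i_l},x_{i_m}\}$; if $X=W_X$, $\Gamma_X:=\emptyset$. The graphic arrangement $\mathcal{A}_{\Gamma_X}$ is the arrangement in $\mathbb{P}^k$ (coordinates indexed by the vertices) with defining equation $\prod_{(i,j)\text{ edge}}(x_i-x_j)$. A graph is chordal if every cycle of length at least $4$ has a chord, i.e. an edge not in the cycle joining two vertices of the cycle; the empty graph is chordal. The product $\mathcal{A}_1\times\mathcal{A}_2$ of arrangements in $\mathbb{P}^a$ and $\mathbb{P}^b$ with equations $f_1(x_0,\dots,x_a)$, $f_2(y_0,\dots,y_b)$ is the arrangement in $\mathbb{P}^{a+b+1}$ with equation $f_1(x)f_2(y)$. Conventions: an empty factor (on an empty set of variables) is omitted from a product and counts as free. *)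

(* Defs.v *)
From HB Require Import structures.
From mathcomp Require Import all_boot all_order all_algebra.
From mathcomp Require Import finmap.
From mathcomp Require Import mpoly.

Set Implicit Arguments.
Unset Strict Implicit.
Unset Printing Implicit Defensive.

Import GRing.Theory.

Local Open Scope fset_scope.
Local Open Scope ring_scope.

Section Arrangements.

Variable k : closedFieldType.

(* A linear form in m variables is the row of its coefficients.  Projective   *)
(* linear subspaces of P^(m-1) are represented by their affine cones in k^m;  *)
(* the empty subspace is 0.  The case m = 0 (no variables) is allowed: its    *)
(* only arrangement is the empty one.                                         *)

Definition form_poly m (l : 'rV[k]_m) : {mpoly k[m]} :=
  \sum_(i < m) l 0 i *: 'X_i.

Definition hyp m (l : 'rV[k]_m) : {vspace 'rV[k]_m} :=
  lker (linfun (mulmxr l^T)).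

(* An arrangement is given by one defining form for each of its hyperplanes.  *)
Definition is_arrangement m (A : {fset 'rV[k]_m}) : Prop :=
  (forall l, l \in A -> l != 0) /\ {in A &, injective (@hyp m)}.

Definition hyps m (A : {fset 'rV[k]_m}) : {fset {vspace 'rV[k]_m}} :=
  [fset hyp l | l in A].

Definition arr_poly m (A : {fset 'rV[k]_m}) : {mpoly k[m]} :=
  \prod_(l <- A) form_poly l.

Definition derivation m (D : {mpoly k[m]} -> {mpoly k[m]}) : Prop :=
  (forall (a : k) p q, D (a *: p + q) = a *: D p + D q) /\
  (forall p q, D (p * q) = D p * q + p * D q).

Definition log_derivation m (A : {fset 'rV[k]_m})
    (D : {mpoly k[m]} -> {mpoly k[m]}) : Prop :=
  derivation D /\ exists g, D (arr_poly A) = g * arr_poly A.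

(* Der(-log A) has a basis of m elements over k[x_0, ..., x_(m-1)].           *)
Definition free_arr m (A : {fset 'rV[k]_m}) : Prop :=
  exists theta : 'I_m -> {mpoly k[m]} -> {mpoly k[m]},
    (forall i, log_derivation A (theta i)) /\
    (forall D, log_derivation A D ->
       exists! c : {ffun 'I_m -> {mpoly k[m]}},
         forall p, D p = \sum_(i < m) c i * theta i p).

Definition arr_iso m1 m2 (A : {fset 'rV[k]_m1}) (B : {fset 'rV[k]_m2}) : Prop :=
  exists2 g : 'Hom('rV[k]_m1, 'rV[k]_m2),
    bijective g & hyps B = [fset (g @: H)%VS | H in hyps A].

Definition arr_prod m1 m2 (A : {fset 'rV[k]_m1}) (B : {fset 'rV[k]_m2}) :
    {fset 'rV[k]_(m1 + m2)} :=
  [fset row_mx l 0 | l in A] `|` [fset row_mx 0 l | l in B].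

Definition lattice m (A : {fset 'rV[k]_m}) (X : {vspace 'rV[k]_m}) : Prop :=
  X != 0%VS /\
  exists B : {fset 'rV[k]_m},
    [/\ B `<=` A, B != fset0 & X = (\bigcap_(l <- B) hyp l)%VS].

Definition localization m (A : {fset 'rV[k]_m}) (X : {vspace 'rV[k]_m}) :
    {fset 'rV[k]_m} :=
  [fset l in A | (X <= hyp l)%VS].

Definition coordH m (i : 'I_m) : {vspace 'rV[k]_m} := hyp (delta_mx 0 i).

Definition coordL m (i j : 'I_m) : {vspace 'rV[k]_m} :=
  (coordH i :&: coordH j)%VS.

Definition hypertetrahedral m (A : {fset 'rV[k]_m}) : Prop :=
  is_arrangement A /\
  (forall l, l \in A -> exists i j : 'I_m, (i < j)%N /\ (coordL i j <= hyp l)%VS).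

Definition complete m (A : {fset 'rV[k]_m}) : Prop :=
  forall i : 'I_m, coordH i \in hyps A.

(* The set H(s_(i,j)); only the values of s at i < j are used.                *)
Definition calH m (s : 'I_m -> 'I_m -> nat) (A : {fset 'rV[k]_m}) : Prop :=
  [/\ hypertetrahedral A, complete A &
      forall i j : 'I_m, (i < j)%N ->
        #|` localization A (coordL i j)| = (s i j + 2)%N].

Definition supp m (l : 'rV[k]_m) : {set 'I_m} := [set i | l 0 i != 0].

Definition arr_supp m (B : {fset 'rV[k]_m}) : {set 'I_m} :=
  \bigcup_(l <- B) supp l.

(* The variables in the support are renumbered increasingly.                  *)
Definition arr_pi m (B : {fset 'rV[k]_m}) : {fset 'rV[k]_#|arr_supp B|} :=
  [fset \row_(i < #|arr_supp B|) (l : 'rV[k]_m) 0 (enum_val i) | l in B].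

(* If X is inner then W X is the whole space rather than the empty set; no    *)
(* hyperplane contains it, so the localization there is empty, as required.   *)
Definition W m (X : {vspace 'rV[k]_m}) : {vspace 'rV[k]_m} :=
  (\bigcap_(i < m | (X <= coordH i)%VS) coordH i)%VS.

Lemma mem_hyp m (l v : 'rV[k]_m) : (v \in hyp l) = (v *m l^T == 0).
Proof. by rewrite memv_ker lfunE. Qed.

Lemma localization_fullv m (A : {fset 'rV[k]_m}) :
  is_arrangement A -> localization A fullv = fset0.
Proof.
move=> [nz _]; apply/fsetP => l; rewrite !inE; apply/negP => /andP[lA /subvP h].
case/negP: (nz l lA); apply/eqP/rowP => i; rewrite mxE.
have := h (delta_mx 0 i) (memvf _); rewrite mem_hyp -rowE => /eqP/rowP/(_ 0).
by rewrite !mxE.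
Qed.

End Arrangements.

Record sgraph (T : finType) := SGraph {
  verts : {set T};
  edge : rel T;
  edge_sym : ssrbool.symmetric edge;
  edge_irr : irreflexive edge;
  edge_verts : forall x y, edge x y -> x \in verts
}.

Definition chordal (T : finType) (G : sgraph T) : Prop :=
  forall c : seq T, ucycle (edge G) c -> (4 <= size c)%N ->
    exists x y, [/\ x \in c, y \in c, edge G x y, y != next c x & x != next c y].

Section Graphs.

Variable k : closedFieldType.

Definition graphic m (G : sgraph 'I_m) : {fset 'rV[k]_#|verts G|} :=
  [fset (delta_mx 0 e.1 - delta_mx 0 e.2 : 'rV[k]_#|verts G|)
     | e in [set e : 'I_#|verts G| * 'I_#|verts G| |
               (e.1 < e.2)%N && edge G (enum_val e.1) (enum_val e.2)]].

Definition supp_edge m (D : {fset 'rV[k]_m}) : rel 'I_m :=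
  fun i j => (i != j) && has (fun l => supp l == [set i; j]) D.

Lemma supp_edge_sym m (D : {fset 'rV[k]_m}) : ssrbool.symmetric (supp_edge D).
Proof.
by move=> i j; rewrite /supp_edge eq_sym; under eq_has => l do rewrite setUC.
Qed.

Lemma supp_edge_irr m (D : {fset 'rV[k]_m}) : irreflexive (supp_edge D).
Proof. by move=> i; rewrite /supp_edge eqxx. Qed.

Lemma supp_edge_verts m (D : {fset 'rV[k]_m}) i j :
  supp_edge D i j -> i \in arr_supp D.
Proof.
case/andP=> _ /hasP[l lD /eqP e]; have: i \in supp l.
  by rewrite e !inE eqxx.
by rewrite /arr_supp (big_rem l lD) /= in_setU => ->.
Qed.

Definition Gamma m (A : {fset 'rV[k]_m}) (X : {vspace 'rV[k]_m}) :
    sgraph 'I_m :=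
  let D := localization A X `\` localization A (W X) in
  SGraph (@supp_edge_sym m D) (@supp_edge_irr m D) (@supp_edge_verts m D).

End Graphs.

(* Main.v *)
Require Import Defs.
From HB Require Import structures.
From mathcomp Require Import all_boot all_order all_algebra.
From mathcomp Require Import fingroup perm ring.
From mathcomp Require Import finmap.
From mathcomp Require Import mpoly.

Set Implicit Arguments.
Unset Strict Implicit.
Unset Printing Implicit Defensive.

Import GRing.Theory.

Local Open Scope fset_scope.
Local Open Scope ring_scope.

(* Logarithmic derivations are encoded by the rows of their values on the       *)
(* variables.  By Saito's criterion an arrangement is free iff some m           *)
(* logarithmic rows have determinant a nonzero scalar multiple of the defining  *)
(* product, and for this it is enough that the quotient by that product does    *)
(* not vanish at the origin: rows may be replaced one at a time by homogeneous  *)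
(* components.                                                                  *)
(*   After rescaling the coordinates by a generic point w of X, the hyperplanes *)
(* of A_X outside A_(W_X) become x_i = x_j for the edges ij of Gamma_X, in      *)
(* variables disjoint from the support of A_(W_X).                              *)
(*   Freezing the variables outside that support at a generic point and         *)
(* exchanging rows against the corresponding unit vectors shows that            *)
(* pi(A_(W_X)) is free when A_X is.                                             *)
(*   For a chordal graph, list the vertices so that the earlier neighbours N(v) *)
(* of each v form a clique; then the derivations                                *)
(* x_y |-> \prod_(u in N(v)) (x_y - x_u), y running over the vertices reached   *)
(* from v by increasing paths (and 0 elsewhere), form a triangular basis.       *)
(*   For a chordless cycle of length r >= 4, restrict the Saito matrix to a     *)
(* line q + t p through a generic point q of the flat of the cycle: the         *)
(* determinant has order at most r in t, but the relation between the r forms   *)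
(* of the cycle makes constant column operations produce one column divisible   *)
(* by t and r - 2 columns divisible by t^2, and 2r - 3 > r.                     *)

(** * Divisibility by linear forms *)

(** Let $I$ be the set of $i$ with $X\subset H_i$. The forms of $\mathcal{A}_{W_X}$ involve only
    variables $x_i$, $i\in I$ ([supp_localization_W]). A form of $\mathcal{A}_X-\mathcal{A}_{W_X}$
    involves exactly two variables, neither indexed by $I$: if one of them vanished on $X$, so would
    the other, and the form would vanish on $W_X$ ([supp_pair], [supp_outside]). So $\mathcal{A}_X$
    splits into two arrangements in disjoint variables. All the two-variable forms vanish at one
    point of $X$ whose coordinates outside $I$ are nonzero ([generic_weights]); dividing by these
    coordinates turns each form into a multiple of a difference of two variables, which is (i),
    [localization_iso]. For (ii), [saito_free] and [free_saito] translate freeness into the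
    existence of a matrix, and [local_saito] relaxes what has to be checked. The factor
    $\pi(\mathcal{A}_{W_X})$ inherits freeness by [free_restriction]; a chordless cycle is excluded
    by [chordless_cycle_not_free]; conversely [chordal_free] multiplies a basis for the first factor
    by the explicit basis [graph_basis] of a chordal graph. *)

Definition divides (R : comNzRingType) (a b : R) : Prop := exists q, b = q * a.

Section Divides.
Variable R : comNzRingType.
Implicit Types a b c : R.

Lemma divides0 a : divides a 0. Proof. by exists 0; rewrite mul0r. Qed.

Lemma divides_refl a : divides a a. Proof. by exists 1; rewrite mul1r. Qed.

Lemma dividesD a b c : divides a b -> divides a c -> divides a (b + c).
Proof. by move=> [x ->] [y ->]; exists (x + y); rewrite mulrDl. Qed.

Lemma dividesMl a b c : divides a b -> divides a (c * b).
Proof. by move=> [x ->]; exists (c * x); rewrite mulrA. Qed.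

Lemma dividesMr a b c : divides a b -> divides a (b * c).
Proof. by rewrite mulrC; apply: dividesMl. Qed.

Lemma dividesN a b : divides a b -> divides a (- b).
Proof. by move=> [x ->]; exists (- x); rewrite mulNr. Qed.

Lemma dividesB a b c : divides a b -> divides a c -> divides a (b - c).
Proof. by move=> ab /dividesN; apply: dividesD. Qed.

Lemma divides_sum (I : Type) (r : seq I) (P : pred I) (F : I -> R) a :
  (forall i, P i -> divides a (F i)) -> divides a (\sum_(i <- r | P i) F i).
Proof.
by move=> h; apply: big_ind => //; [exact: divides0 | exact: dividesD].
Qed.

Lemma divides_trans a b c : divides a b -> divides b c -> divides a c.
Proof. by move=> [x ->] [y ->]; exists (y * x); rewrite mulrA. Qed.

Lemma divides_prod (I : eqType) (r : seq I) (F : I -> R) i :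
  i \in r -> divides (F i) (\prod_(j <- r) F j).
Proof. by move=> ir; rewrite (big_rem i ir) /= mulrC;
  exists (\prod_(j <- rem i r) F j). Qed.

Lemma divides_det n (M : 'M[R]_n) j a :
  (forall i, divides a (M i j)) -> divides a (\det M).
Proof.
move=> h; rewrite (expand_det_col M j); apply: divides_sum => i _.
exact: dividesMr.
Qed.

Lemma divides_morph (S : comNzRingType) (f : {rmorphism R -> S}) a b :
  divides a b -> divides (f a) (f b).
Proof. by move=> [x ->]; exists (f x); rewrite rmorphM. Qed.

End Divides.

Section LinearForms.

Variable k : closedFieldType.

Lemma mpoly_ring_ind m (P : {mpoly k[m]} -> Prop) :
  (forall c, P c%:MP) -> (forall i, P 'X_i) ->
  (forall p q, P p -> P q -> P (p + q)) ->
  (forall p q, P p -> P q -> P (p * q)) -> forall p, P p.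
Proof.
move=> PC PX PD PM; apply: mpolyind => [|c u p _ _ Pp]; first exact: (PC 0).
apply/PD => //; rewrite -mul_mpolyC; apply/PM => //.
rewrite mpolyXE_id; apply: (big_ind P) => [||i _]; [exact: (PC 1) | exact: PM |].
elim: (u i) => [|e IH]; first by rewrite expr0; apply: (PC 1).
by rewrite exprS; apply/PM.
Qed.

(* Substitution along the projection onto the hyperplane [l = 0] parallel to  *)
(* the [i]-th axis; its kernel is the ideal generated by [l].                 *)
Definition form_reduce m (l : 'rV[k]_m) (i : 'I_m) :
    {mpoly k[m]} -> {mpoly k[m]} :=
  mmap (@mpolyC m k) (fun j => 'X_j - ((j == i)%:R / l 0 i) *: form_poly l).

HB.instance Definition _ m (l : 'rV[k]_m) (i : 'I_m) :=
  GRing.RMorphism.copy (form_reduce l i) (form_reduce l i).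

Lemma form_reduceC m (l : 'rV[k]_m) i c : form_reduce l i c%:MP = c%:MP.
Proof. exact: mmapC. Qed.

Lemma form_reduceX m (l : 'rV[k]_m) i j :
  form_reduce l i 'X_j = 'X_j - ((j == i)%:R / l 0 i) *: form_poly l.
Proof. by rewrite /form_reduce mmapX mmap1U. Qed.

Lemma form_reduceZ m (l : 'rV[k]_m) i c p :
  form_reduce l i (c *: p) = c *: form_reduce l i p.
Proof. by rewrite -!mul_mpolyC rmorphM /= form_reduceC. Qed.

Lemma form_reduce_form m (l : 'rV[k]_m) i :
  l 0 i != 0 -> form_reduce l i (form_poly l) = 0.
Proof.
move=> li; rewrite [in LHS]/form_poly rmorph_sum /=.
under eq_bigr => j _ do rewrite form_reduceZ form_reduceX scalerBr scalerA.
rewrite sumrB -/(form_poly l) -scaler_suml (bigD1 i) //= big1 => [|j /negPf->].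
  by rewrite eqxx mul1r divff // addr0 scale1r subrr.
by rewrite mul0r mulr0.
Qed.

Lemma form_reduce_mod m (l : 'rV[k]_m) i p :
  divides (form_poly l) (p - form_reduce l i p).
Proof.
apply: (mpoly_ring_ind (P := fun p => divides (form_poly l) (p - form_reduce l i p))) p
  => [c|j|p q hp hq|p q hp hq].
- by rewrite form_reduceC subrr; apply: divides0.
- rewrite form_reduceX opprB addrC subrK -mul_mpolyC.
  exact/dividesMl/divides_refl.
- by rewrite rmorphD opprD addrACA; apply: dividesD.
- rewrite rmorphM /=.
  rewrite (_ : p * q - _ = p * (q - form_reduce l i q)
             + (p - form_reduce l i p) * form_reduce l i q); last first.
    by rewrite mulrBr mulrBl addrA subrK.
  by apply: dividesD; [apply: dividesMl | apply: dividesMr].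
Qed.

Lemma form_dividesP m (l : 'rV[k]_m) i p : l 0 i != 0 ->
  divides (form_poly l) p <-> form_reduce l i p = 0.
Proof.
move=> li; split => [[q ->]|h].
  by rewrite rmorphM /= form_reduce_form // mulr0.
by have := form_reduce_mod l i p; rewrite h subr0.
Qed.

Lemma rV_neq0 m (l : 'rV[k]_m) : l != 0 -> {i | l 0 i != 0}.
Proof.
move=> nz; case: (pickP (fun i => l 0 i != 0)) => [i li|h]; first by exists i.
by case/eqP: nz; apply/rowP => i; rewrite mxE; apply/eqP; move: (h i) => /negbFE.
Qed.

(** The ideal of the form is the kernel of [form_reduce], a ring morphism into an integral
    domain. *)
Lemma form_prime m (l : 'rV[k]_m) p q : l != 0 ->
  divides (form_poly l) (p * q) ->
  divides (form_poly l) p \/ divides (form_poly l) q.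
Proof.
case/rV_neq0 => i li /(form_dividesP _ li); rewrite rmorphM /= => /eqP.
rewrite mulf_eq0 => /orP[] /eqP h; [left|right]; exact/(form_dividesP _ li).
Qed.

Lemma meval_form m (l : 'rV[k]_m) (v : 'I_m -> k) :
  (form_poly l).@[v] = \sum_i l 0 i * v i.
Proof.
by rewrite /form_poly rmorph_sum /=; apply: eq_bigr => i _; rewrite mevalZ mevalXU.
Qed.

Lemma form_poly_eq0 m (l : 'rV[k]_m) : (form_poly l == 0) = (l == 0).
Proof.
apply/eqP/eqP => [h|->]; last first.
  by rewrite /form_poly big1 // => i _; rewrite mxE scale0r.
apply/rowP => i; have := meval_form l (fun j => (j == i)%:R).
rewrite h meval0 (bigD1 i) //= big1 => [|j /negPf->]; last by rewrite mulr0.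
by rewrite eqxx mulr1 addr0 mxE => <-.
Qed.

Lemma mem_hypE m (l v : 'rV[k]_m) : (v \in hyp l) = (\sum_i l 0 i * v 0 i == 0).
Proof.
rewrite mem_hyp; apply/eqP/eqP => [/matrixP/(_ 0 0)|h].
  rewrite !mxE => {2}<-; apply: eq_bigr => i _; by rewrite !mxE mulrC.
apply/matrixP => a b; rewrite !ord1 !mxE -{2}h; apply: eq_bigr => i _.
by rewrite !mxE mulrC.
Qed.

Lemma subv_hypP m (l l' : 'rV[k]_m) : l != 0 -> l' != 0 ->
  (hyp l <= hyp l')%VS -> exists2 c, c != 0 & l' = c *: l.
Proof.
move=> /rV_neq0[i li] l'0 /subvP sub.
have l'E : l' = (l' 0 i / l 0 i) *: l.
  apply/rowP => j; rewrite mxE.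
  (* These vectors span the kernel of [l]; evaluating [l'] on them expresses each of its
     coefficients through the one at [i]. *)
  pose v : 'rV[k]_m := delta_mx 0 j - (l 0 j / l 0 i) *: delta_mx 0 i.
  have sumv (a : 'rV[k]_m) : \sum_x a 0 x * v 0 x = a 0 j - l 0 j / l 0 i * a 0 i.
    under eq_bigr => x _ do rewrite !mxE eqxx /= mulrBr.
    rewrite sumrB (bigD1 j) //= [X in _ - X](bigD1 i) //= !eqxx.
    rewrite !big1 ?addr0 ?mulr1; first by rewrite mulrC.
      by move=> x /negPf->; rewrite !mulr0.
    by move=> x /negPf->; rewrite mulr0.
  have /sub : v \in hyp l by rewrite mem_hypE sumv divfK // subrr.
  rewrite mem_hypE sumv subr_eq0 => /eqP ->.
  by rewrite mulrC [l 0 j / _]mulrC mulrA.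
exists (l' 0 i / l 0 i) => //; apply: contra_neq l'0 => h.
by rewrite l'E h scale0r.
Qed.

Lemma hypZ m (l : 'rV[k]_m) c : c != 0 -> hyp (c *: l) = hyp l.
Proof.
move=> c0; apply/vspaceP => v; rewrite !mem_hypE.
under eq_bigr => i _ do rewrite mxE -mulrA.
by rewrite -mulr_sumr mulf_eq0 (negPf c0).
Qed.

Lemma form_divides_hyp m (l l' : 'rV[k]_m) : l != 0 -> l' != 0 ->
  divides (form_poly l) (form_poly l') -> hyp l = hyp l'.
Proof.
move=> l0 l'0 [q e]; have [|c c0 ->] := @subv_hypP _ l l' l0 l'0.
  apply/subvP => v; rewrite !mem_hypE -!meval_form e mevalM => /eqP->.
  by rewrite mulr0.
by rewrite hypZ.
Qed.

Definition form_prod m (s : seq 'rV[k]_m) : {mpoly k[m]} :=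
  \prod_(l <- s) form_poly l.

(** Arrangements restated for factorization: the forms are primes, no two of them associate. *)
Definition coprime_forms m (s : seq 'rV[k]_m) : Prop :=
  (forall l, l \in s -> l != 0) /\
  {in s &, forall l l', divides (form_poly l) (form_poly l') -> l = l'}.

Lemma arrangement_coprime m (A : {fset 'rV[k]_m}) :
  is_arrangement A -> coprime_forms A.
Proof.
move=> [nz inj]; split => // l l' lA l'A d; apply: inj => //.
by apply: form_divides_hyp => //; apply: nz.
Qed.

Lemma form_prod_neq0 m (s : seq 'rV[k]_m) :
  (forall l, l \in s -> l != 0) -> form_prod s != 0.
Proof.
move=> nz; rewrite prodf_seq_neq0; apply/allP => l ls /=.
by rewrite form_poly_eq0 nz.
Qed.

Lemma form_prime_prod m (s : seq 'rV[k]_m) l : l != 0 ->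
  divides (form_poly l) (form_prod s) ->
  exists2 l', l' \in s & divides (form_poly l) (form_poly l').
Proof.
move=> l0; elim: s => [|a s IH]; rewrite /form_prod ?big_nil ?big_cons => d.
  have [i li] := rV_neq0 l0; move/(form_dividesP _ li): d.
  by rewrite rmorph1 => /eqP; rewrite oner_eq0.
have [d'|/IH[l' l's dl']] := form_prime l0 d.
  by exists a; rewrite // mem_head.
by exists l'; rewrite // inE l's orbT.
Qed.

Lemma form_prod_divides m (s : seq 'rV[k]_m) p :
  coprime_forms s -> uniq s ->
  (forall l, l \in s -> divides (form_poly l) p) -> divides (form_prod s) p.
Proof.
elim: s p => [|a s IH] p [nz cop] us hd.
  by rewrite /form_prod big_nil; exists p; rewrite mulr1.
have [/= as' us'] := andP us.
have [q pE] : divides (form_prod s) p.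
  apply: IH => // [|l ls]; last by apply: hd; rewrite inE ls orbT.
  split=> [l ls|l l' ls l's]; first by apply: nz; rewrite inE ls orbT.
  by apply: cop; rewrite inE ?ls ?l's orbT.
have a0 : a != 0 by apply: nz; rewrite mem_head.
have := hd a (mem_head _ _); rewrite pE => /(form_prime a0)[].
  by move=> [q' ->]; exists q'; rewrite /form_prod big_cons mulrA.
case/(form_prime_prod a0) => l' l's /cop e; case/negP: as'.
by rewrite e ?mem_head // inE l's orbT.
Qed.

(** Each form divides [h * q] but not [h], so it can be cancelled from [q]; in the end [h] divides
    1. Repetitions in [s] are allowed, so powers of a defining polynomial are covered. *)
Lemma divisor_of_form_prod m (s : seq 'rV[k]_m) h q :
  (forall l, l \in s -> l != 0) -> h * q = form_prod s ->
  (forall l, l \in s -> ~ divides (form_poly l) h) ->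
  exists2 c, c != 0 & h = c%:MP.
Proof.
elim: s q => [|a s IH] q nz e ndiv.
  rewrite /form_prod big_nil in e.
  have h0 : h != 0 by apply: contra_eq_neq e => ->; rewrite mul0r eq_sym oner_eq0.
  have q0 : q != 0 by apply: contra_eq_neq e => ->; rewrite mulr0 eq_sym oner_eq0.
  have := congr1 (fun x => msize x) e; rewrite msizeM // msize1.
  move=> sz; apply/msize_poly1P.
  have: (0 < msize h)%N by rewrite lt0n msize_poly_eq0.
  have: (0 < msize q)%N by rewrite lt0n msize_poly_eq0.
  case: (msize h) (msize q) sz => [|[|x]] [|[|y]] //=; by rewrite ?addnS.
have a0 : a != 0 by apply: nz; rewrite mem_head.
have fa0 : form_poly a != 0 by rewrite form_poly_eq0.
have [] := form_prime (p := h) (q := q) a0.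
- by rewrite e /form_prod big_cons; exact/dividesMr/divides_refl.
- by move/ndiv; rewrite mem_head => /(_ isT).
move=> [q' qE]; apply: (IH q') => [l ls||l ls].
- by apply: nz; rewrite inE ls orbT.
- apply: (mulIf fa0); rewrite -mulrA -qE e /form_prod big_cons mulrC //.
- by apply: ndiv; rewrite inE ls orbT.
Qed.

Lemma form_prod_homog m (s : seq 'rV[k]_m) : form_prod s \is (size s).-homog.
Proof.
elim: s => [|l s IH]; rewrite /form_prod ?big_nil ?big_cons; first exact: dhomog1.
rewrite -[size _]/(1 + size s)%N; apply: dhomogM => //.
rewrite /form_poly; apply: rpred_sum => i _; apply: rpredZ.
by rewrite dhomogX; apply/eqP/mdeg1.
Qed.

End LinearForms.

(** * Saito's criterion *)

Section Determinants.

Variable R : comNzRingType.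

(** A permutation contributing a nonzero product never lowers [r]. Since it preserves the sum of [r]
    over all indices, it raises [r] nowhere and hence is the identity. *)
Lemma det_triangular_rank n (M : 'M[R]_n) (r : 'I_n -> nat) :
  (forall i j, i != j -> M i j != 0 -> (r i < r j)%N) ->
  \det M = \prod_i M i i.
Proof.
move=> tri; rewrite /determinant (bigD1 1%g) //= odd_perm1 mul1r.
rewrite [X in _ + X]big1 ?addr0; first by apply: eq_bigr => i _; rewrite perm1.
move=> s s1; have [/forallP nz|] := boolP [forall i, M i (s i) != 0]; last first.
  case/forallPn => i /negPn/eqP z.
  by rewrite (bigD1 i) //= z mul0r mulr0.
have le i : (r i <= r (s i) ?= iff (s i == i))%N.
  split; have [e|ne] := eqVneq i (s i).
  - by rewrite -e.
  - exact/ltnW/tri.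
  - by rewrite -e !eqxx.
  - by rewrite ltn_eqF ?tri //; apply: esym; apply: negbTE; rewrite eq_sym.
have [_] := leqif_sum (P := xpredT) (fun i _ => le i).
rewrite [X in _ == X](reindex_inj (@perm_inj _ s^-1)) /=.
under [X in _ == X]eq_bigr => i _ do rewrite permKV.
rewrite eqxx => /esym/forallP e; case/eqP: s1; apply/permP => i.
by rewrite perm1; exact/eqP/e.
Qed.

Definition set_row n (M : 'M[R]_n) (i : 'I_n) (r : 'I_n -> R) : 'M[R]_n :=
  \matrix_(a, b) (if a == i then r b else M a b).

Lemma det_set_row n (M : 'M[R]_n) i r :
  \det (set_row M i r) = \sum_j r j * cofactor M i j.
Proof.
rewrite (expand_det_row _ i); apply: eq_bigr => j _; rewrite mxE eqxx.
congr (_ * (_ * \det _)); apply/matrixP => a b.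
by rewrite !mxE eq_sym (negPf (neq_lift _ _)).
Qed.

Lemma set_row_id n (M : 'M[R]_n) i : set_row M i (M i) = M.
Proof. by apply/matrixP => a b; rewrite mxE; case: eqP => [->|]. Qed.

(** Cramer's rule. *)
Lemma mulmx_adj_row n (M : 'M[R]_n) (r : 'rV[R]_n) i :
  (r *m \adj M) 0 i = \det (set_row M i (r 0)).
Proof. by rewrite det_set_row !mxE; apply: eq_bigr => j _; rewrite !mxE. Qed.

(* Put the combination of the columns of [M] with coefficients [a] in the     *)
(* place of column [j]; this multiplies the determinant by [a j].             *)
Lemma divides_det_comb n (M : 'M[R]_n) (a : 'I_n -> R) j d :
  (forall i, divides d (\sum_b a b * M i b)) -> divides d (a j * \det M).
Proof.
move=> h; pose Q : 'M[R]_n := \matrix_(b, c) (if c == j then a b else (b == c)%:R).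
have -> : a j * \det M = \det (M *m Q).
  rewrite det_mulmx mulrC; congr (_ * _); apply: esym.
  rewrite (det_triangular_rank (r := fun i => (i == j) : nat)).
    rewrite (bigD1 j) //= mxE eqxx big1 ?mulr1 // => i /negPf ij.
    by rewrite mxE ij eqxx.
  move=> b c /negPf bc; rewrite mxE bc.
  by case: (eqVneq c j) bc => [-> ->|_ _]; rewrite ?eqxx.
apply: (divides_det (j := j)) => i; rewrite mxE.
under eq_bigr => b _ do rewrite mxE eqxx mulrC.
exact: h.
Qed.

End Determinants.

Section Saito.

Variable k : closedFieldType.

(** The value on [l] of the derivation sending the variable $x_j$ to [r j]. The entries may live in
    another number of variables, as happens after some variables are frozen. *)
Definition pairing m n (l : 'rV[k]_m) (r : 'I_m -> {mpoly k[n]}) : {mpoly k[n]} :=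
  \sum_j l 0 j *: r j.

Definition log_coeffs m (s : seq 'rV[k]_m) (r : 'I_m -> {mpoly k[m]}) : Prop :=
  forall l, l \in s -> divides (form_poly l) (pairing l r).

Lemma divides_det_pairing m n (M : 'M[{mpoly k[n]}]_m) (l : 'rV[k]_m) d :
  l != 0 -> (forall i, divides d (pairing l (M i))) -> divides d (\det M).
Proof.
move=> /rV_neq0[j lj] h.
have [|q e] := @divides_det_comb _ _ M (fun b => (l 0 b)%:MP) j d.
  move=> i; rewrite (_ : \sum_b _ = pairing l (M i)) //.
  by apply: eq_bigr => b _; rewrite mul_mpolyC.
exists ((l 0 j)^-1 *: q); rewrite -scalerAl -e mul_mpolyC scalerA mulVf //.
by rewrite scale1r.
Qed.

Lemma mderivXU m (i j : 'I_m) : ('X_i : {mpoly k[m]})^`M(j) = (i == j)%:R.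
Proof.
rewrite mderivX mnm1E; case: eqP => [->|_]; last by rewrite scale0r.
rewrite (_ : (U_(j) - U_(j))%MM = 0%MM) ?mpolyX0 ?scale1r //.
by apply/mnmP => i'; rewrite mnmE subnn mnm0E.
Qed.

Lemma derivationE m (D : {mpoly k[m]} -> {mpoly k[m]}) p :
  derivation D -> D p = \sum_j D 'X_j * p^`M(j).
Proof.
move=> [Dl DM]; have DD x y : D (x + y) = D x + D y.
  by rewrite -[x]scale1r Dl !scale1r.
have D0 : D 0 = 0 by apply: (addrI (D 0)); rewrite -DD !addr0.
have DZ a x : D (a *: x) = a *: D x by rewrite -[a *: x]addr0 Dl D0 addr0.
have D1 : D 1 = 0.
  by apply: (addrI (D 1)); rewrite addr0 -{3}[1]mulr1 DM mul1r mulr1.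
apply: (mpoly_ring_ind (P := fun p => D p = \sum_j D 'X_j * p^`M(j))) p
  => [c|i|p q hp hq|p q hp hq].
- rewrite -[c%:MP]mulr1 mul_mpolyC DZ D1 scaler0 big1 // => i _.
  by rewrite mderivZ -mpolyC1 mderivC scaler0 mulr0.
- rewrite (bigD1 i) //= big1 => [|j /negPf ji]; rewrite mderivXU.
    by rewrite eqxx mulr1 addr0.
  by rewrite eq_sym ji mulr0.
- by rewrite DD hp hq -big_split; apply: eq_bigr => j _; rewrite mderivD mulrDr.
- rewrite DM hp hq mulr_suml mulr_sumr -big_split; apply: eq_bigr => j _ /=.
  by rewrite mderivM; ring.
Qed.

Definition der_of m (r : 'I_m -> {mpoly k[m]}) (p : {mpoly k[m]}) :=
  \sum_j r j * p^`M(j).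

Lemma der_of_derivation m (r : 'I_m -> {mpoly k[m]}) : derivation (der_of r).
Proof.
split=> [a p q|p q]; rewrite /der_of.
  rewrite scaler_sumr -big_split; apply: eq_bigr => j _ /=.
  by rewrite mderivD mderivZ mulrDr scalerAr.
rewrite mulr_suml mulr_sumr -big_split; apply: eq_bigr => j _ /=.
by rewrite mderivM; ring.
Qed.

Lemma der_ofX m (r : 'I_m -> {mpoly k[m]}) i : der_of r 'X_i = r i.
Proof.
rewrite /der_of (bigD1 i) //= big1 => [|j /negPf ji]; rewrite mderivXU.
  by rewrite eqxx mulr1 addr0.
by rewrite eq_sym ji mulr0.
Qed.

Lemma derivation_form m (D : {mpoly k[m]} -> {mpoly k[m]}) l :
  derivation D -> D (form_poly l) = pairing l (fun j => D 'X_j).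
Proof.
move=> dD; rewrite derivationE //; apply: eq_bigr => j _.
rewrite /form_poly [X in _ * X]raddf_sum /= (bigD1 j) //= big1 => [|i /negPf ij];
  rewrite mderivZ mderivXU.
  by rewrite eqxx addr0 -scalerAr mulr1.
by rewrite ij scaler0.
Qed.

(** Write the defining product as $l g$. If it divides $D(l)g + lD(g)$, then $l$ divides $D(l)g$,
    hence $D(l)$, as $l$ is prime and does not divide $g$. The converse is the Leibniz rule, one
    factor at a time. *)
Lemma log_derivationP m (A : {fset 'rV[k]_m}) D : coprime_forms A ->
  log_derivation A D <-> derivation D /\ log_coeffs A (fun j => D 'X_j).
Proof.
move=> [nz cop]; split=> -[dD h]; split => //; have [Dl DM] := dD.
  move=> l lA; rewrite -derivation_form //; case: h => g.
  rewrite /arr_poly (big_rem l lA) /= DM => e.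
  have: divides (form_poly l) (D (form_poly l) * form_prod (rem l A)).
    rewrite -[X in divides _ X](addrK (form_poly l * D (form_prod (rem l A)))) e.
    apply: dividesB; last exact/dividesMr/divides_refl.
    exact/dividesMl/dividesMr/divides_refl.
  case/(form_prime (nz _ lA)) => // /(form_prime_prod (nz _ lA))[l' l'A].
  have l'A' := mem_rem l'A; move/(cop _ _ lA l'A') => e'.
  by move: l'A; rewrite -e' mem_rem_uniqF // fset_uniq.
suff: forall s : seq 'rV[k]_m, {subset s <= A} -> divides (form_prod s) (D (form_prod s)).
  by move/(_ (enum_fset A) (fun _ => id)).
elim=> [|l s IH] sA; rewrite /form_prod ?big_nil ?big_cons.
  by exists (D 1); rewrite mulr1.
rewrite DM; have [|q e] := IH; first by move=> x xs; apply: sA; rewrite inE xs orbT.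
have [|g e'] := h l; first by apply: sA; rewrite mem_head.
rewrite derivation_form // e' e; exists (g + q).
by rewrite mulrDl; congr (_ + _); rewrite -?mulrA // mulrCA.
Qed.

Definition saito_basis m (s : seq 'rV[k]_m) (M : 'M[{mpoly k[m]}]_m) : Prop :=
  (forall i, log_coeffs s (M i)) /\
  exists2 c, c != 0 & \det M = c *: form_prod s.

Lemma form_prod_divides_det m (s : seq 'rV[k]_m) (M : 'M[{mpoly k[m]}]_m) :
  coprime_forms s -> uniq s -> (forall i, log_coeffs s (M i)) ->
  divides (form_prod s) (\det M).
Proof.
move=> cop us h; apply: form_prod_divides => // l ls.
apply: (@divides_det_pairing _ _ _ l); first by case: cop => /(_ _ ls).
by move=> i; apply: h.
Qed.

Lemma log_coeffs_poly m (s : seq 'rV[k]_m) (r : 'I_m -> {mpoly k[m]}) p :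
  divides (form_prod s) p -> log_coeffs s (fun j => p * r j).
Proof.
move=> d l ls; apply: divides_sum => j _; rewrite -mul_mpolyC.
by apply/dividesMl/dividesMr; apply: divides_trans d; apply: divides_prod.
Qed.

(** By Cramer's rule the coordinates of a logarithmic row in the rows of [M] are determinants of
    logarithmic rows divided by $\det M$. The numerators are multiples of the defining product, and
    $\det M$ is a scalar times it, so the quotients are polynomials. *)
Lemma saito_free m (A : {fset 'rV[k]_m}) M : coprime_forms A ->
  saito_basis A M -> free_arr A.
Proof.
move=> cop [logM [c c0 detM]]; have [nz _] := cop.
have f0 : form_prod A != 0 by exact: form_prod_neq0.
have detM0 : \det M != 0 by rewrite detM scaler_eq0 negb_or c0 f0.
exists (fun i => der_of (M i)); split=> [i|D /(log_derivationP _ cop)[dD logD]].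
  apply/log_derivationP => //; split; first exact: der_of_derivation.
  move=> l lA; rewrite /pairing.
  under eq_bigr => j _ do rewrite der_ofX.
  exact: logM.
pose r : 'rV[{mpoly k[m]}]_m := \row_j D 'X_j.
have /fin_all_exists[q qE] : forall i, exists q,
    (r *m \adj M) 0 i = q * form_prod A.
  move=> i; rewrite mulmx_adj_row; apply: form_prod_divides_det; rewrite ?fset_uniq //.
  move=> a l lA; rewrite (_ : pairing _ _ =
     pairing l (if a == i then fun j => D 'X_j else M a)).
    by case: eqP => _; [apply: logD | apply: logM].
  by apply: eq_bigr => j _; rewrite mxE; case: eqP => // _; rewrite mxE.
exists [ffun i => c^-1 *: q i]; split=> [p|b bE].
  rewrite derivationE //; rewrite /der_of.
  under [RHS]eq_bigr => i _ do rewrite mulr_sumr.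
  rewrite exchange_big; apply: eq_bigr => j _ /=.
  have: (r *m \adj M *m M) 0 j = \det M * D 'X_j.
    by rewrite -mulmxA mul_adj_mx mul_mx_scalar !mxE.
  rewrite mxE (eq_bigr (fun i => q i * form_prod A * M i j)) => [|i _]; last first.
    by congr (_ * _); apply: qE.
  rewrite detM => e; have {}e : D 'X_j = \sum_i c^-1 *: (q i * M i j).
    apply: (mulfI f0); apply: (scalerI c0).
    rewrite -scalerAl in e; rewrite -e mulr_sumr scaler_sumr.
    apply: eq_bigr => i _; rewrite -scalerAr scalerA mulfV // scale1r.
    by rewrite mulrA [form_prod _ * _]mulrC.
  rewrite e mulr_suml; apply: eq_bigr => i _; rewrite ffunE.
  by rewrite -!scalerAl mulrA.
apply/ffunP => i; rewrite ffunE.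
pose bv : 'rV[{mpoly k[m]}]_m := \row_i b i.
have bM : bv *m M = r.
  apply/rowP => j; rewrite !mxE bE; apply: eq_bigr => a _.
  by rewrite mxE der_ofX.
have : (r *m \adj M) 0 i = b i * \det M.
  by rewrite -bM -mulmxA mul_mx_adj mul_mx_scalar !mxE mulrC.
rewrite [LHS]qE detM -scalerAr => e; apply: (mulIf f0); rewrite -scalerAl e.
by rewrite scalerA mulVf // scale1r.
Qed.

(** For a basis with matrix [M], the determinant of any logarithmic rows is a multiple of $\det M =
    h f$. Two kinds of test rows force [h] to be constant: $f$ times the identity shows that [h]
    divides a power of $f$, and a special matrix for each form [l] of [A] shows that [l] does not
    divide [h]. *)
Lemma free_saito m (A : {fset 'rV[k]_m}) : coprime_forms A ->
  free_arr A -> exists M, saito_basis A M.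
Proof.
move=> cop [theta [logt gen]]; have [nz dist] := cop.
have uA := fset_uniq A.
pose f := form_prod A; have f0 : f != 0 by exact: form_prod_neq0.
pose M : 'M[{mpoly k[m]}]_m := \matrix_(i, j) theta i 'X_j.
have logM i : log_coeffs A (M i).
  move=> l lA; have /(log_derivationP _ cop)[_ /(_ l lA)] := logt i.
  by congr divides; apply: eq_bigr => j _; rewrite mxE.
have spans (N : 'M[{mpoly k[m]}]_m) :
    (forall i, log_coeffs A (N i)) -> divides (\det M) (\det N).
  move=> logN.
  have /fin_all_exists[C CE] : forall i, exists c : {ffun 'I_m -> {mpoly k[m]}},
      forall j, N i j = \sum_a c a * M a j.
    move=> i; have [|c [cE _]] := gen (der_of (N i)).
      apply/log_derivationP => //; split; first exact: der_of_derivation.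
      move=> l lA; rewrite /pairing.
      by under eq_bigr => j _ do rewrite der_ofX; apply: logN.
    exists c => j; rewrite -(der_ofX (N i)) cE; apply: eq_bigr => a _.
    by rewrite mxE.
  exists (\det (\matrix_(i, a) C i a)); rewrite -det_mulmx; congr (\det _).
  by apply/matrixP => i j; rewrite !mxE CE; apply: eq_bigr => a _; rewrite !mxE.
have [h hE] : divides f (\det M) by exact: form_prod_divides_det.
exists M; split=> //; rewrite hE.
suff [c c0 ->] : exists2 c, c != 0 & h = c%:MP by exists c; rewrite // mul_mpolyC.
have ndiv l : l \in A -> ~ divides (form_poly l) h.
  move=> lA; have l0 := nz l lA; have [i0 li0] := rV_neq0 l0.
  pose g := form_prod (rem l A); have fE : f = form_poly l * g.
    by rewrite /f /form_prod (big_rem l lA).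
  (* Row [i0] is $f e_{i_0}$; the others are $g(l_{i_0}e_i - l_i e_{i_0})$, which kill [l] and are
     multiples of all the other forms. The determinant is a nonzero scalar times $l g^m$, so it
     contains [l] only once, while $hf$ would contain it twice if [l] divided [h]. *)
  pose N : 'M[{mpoly k[m]}]_m := \matrix_(i, j)
    if i == i0 then f * (j == i0)%:R
    else g * ((l 0 i0 *+ (j == i))%:MP - (l 0 i *+ (j == i0))%:MP).
  have logN i : log_coeffs A (N i).
    have [e|ne] := eqVneq i i0.
      move=> a aA; have := log_coeffs_poly (fun j => (j == i0)%:R) (divides_refl f) aA.
      by congr divides; apply: eq_bigr => j _; rewrite mxE e eqxx.
    move=> a aA; have [eal|al] := eqVneq a l.
      rewrite (_ : pairing _ _ = 0); first exact: divides0.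
      rewrite eal /pairing (eq_bigr (fun j =>
          g * (l 0 i0 * (l 0 j *+ (j == i)) - l 0 i * (l 0 j *+ (j == i0)))%:MP)).
        rewrite -mulr_sumr -rmorph_sum sumrB (bigD1 i) //= [X in _ - X](bigD1 i0) //=.
        rewrite !eqxx !mulr1n !big1.
        + by rewrite !addr0 [l 0 i0 * _]mulrC subrr mpolyC0 mulr0.
        + by move=> j /negPf->; rewrite mulr0.
        + by move=> j /negPf->; rewrite mulr0.
      move=> j _; rewrite mxE (negPf ne) -mpolyCB -mul_mpolyC mulrCA -mpolyCM.
      congr (_ * _%:MP); rewrite mulrBr !mulrnAr.
      by congr (_ *+ _ - _ *+ _); rewrite mulrC.
    have ar : a \in rem l A by rewrite mem_rem_uniq // inE al.
    rewrite /pairing; apply: divides_sum => j _; rewrite mxE (negPf ne).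
    rewrite -mul_mpolyC; apply/dividesMl/dividesMr.
    exact: (divides_prod _ ar).
  have [q] := spans _ logN.
  have -> : \det N = form_poly l * ((l 0 i0) ^+ #|[pred i | i != i0]|)%:MP
      * g ^+ #|[pred i : 'I_m | true]|.
    rewrite (det_triangular_rank (r := fun i => (i == i0) : nat)); last first.
      move=> i j /negPf ij; rewrite mxE; case: (eqVneq i i0) => [e|ne].
        by rewrite -e [j == i]eq_sym ij mulr0 eqxx.
      rewrite [j == i]eq_sym ij mulr0n sub0r -mpolyCN.
      by case: (eqVneq j i0) => // _; rewrite mulr0n oppr0 mpolyC0 mulr0 eqxx.
    rewrite (bigD1 i0) //= mxE !eqxx mulr1 fE.
    under eq_bigr => i /negPf ne do
      rewrite mxE ne eqxx mulr1n mulr0n mpolyC0 subr0.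
    rewrite big_split /= !prodr_const rmorphXn /=.
    have -> : #|[pred i : 'I_m | true]| = #|[pred i | i != i0]|.+1.
      by rewrite (cardD1 i0) inE add1n; congr _.+1; apply: eq_card => i; rewrite !inE andbT.
    by rewrite exprS; ring.
  rewrite hE fE => e [h' h'E].
  have lf0 : form_poly l != 0 by rewrite form_poly_eq0.
  have: divides (form_poly l) (((l 0 i0) ^+ #|[pred i | i != i0]|)%:MP
      * g ^+ #|[pred i : 'I_m | true]|).
    exists (q * h' * g); apply: (mulfI lf0); rewrite mulrA e h'E.
    by ring.
  case/(form_prime l0) => [[x]|].
    have [i li] := rV_neq0 l0.
    move/(congr1 (fun p => form_reduce l i p)).
    rewrite /= form_reduceC rmorphM /= form_reduce_form // mulr0 => /eqP.
    by rewrite mpolyC_eq0 expf_eq0 (negPf li0) andbF.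
  elim: #|_| => [[x]|n IH].
    have [i li] := rV_neq0 l0; rewrite expr0.
    move/(congr1 (fun p => form_reduce l i p)).
    rewrite /= rmorph1 rmorphM /= form_reduce_form // mulr0 => /eqP.
    by rewrite oner_eq0.
  rewrite exprS => /(form_prime l0)[] // /(form_prime_prod l0)[l' l'A].
  have l'A' := mem_rem l'A; move/(dist _ _ lA l'A') => e'.
  by move: l'A; rewrite -e' mem_rem_uniqF.
have [|q qE] := spans (f%:M).
  move=> i l lA; have := log_coeffs_poly (fun j => (i == j)%:R) (divides_refl f) lA.
  by congr divides; apply: eq_bigr => j _; rewrite !mxE mulr_natr.
(* The list repeats [A] [m] times, so its product is $f^m$, the determinant of $f$ times the
   identity. *)
apply: (@divisor_of_form_prod _ _ (flatten (nseq m (A : seq _))) h (q * f)).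
- by move=> l /flattenP[s /nseqP[-> _]]; apply: nz.
- have pow n : form_prod (flatten (nseq n (A : seq _))) = f ^+ n.
    elim: n => [|n IH]; first by rewrite /form_prod big_nil expr0.
    by rewrite /form_prod /= big_cat exprS -IH.
  by rewrite pow -det_scalar qE hE; ring.
- by move=> l /flattenP[s /nseqP[-> _]]; apply: ndiv.
Qed.

End Saito.

(** * Saito's criterion tested at the origin *)

Section LocalCriterion.

Variable k : closedFieldType.

Lemma pihomog0C m (u : {mpoly k[m]}) : pihomog mdeg 0 u = (u@_0%MM)%:MP.
Proof.
set v := pihomog mdeg 0 u; have hv : v \is 0.-homog by apply: pihomogP.
have vC : v = (v@_0%MM)%:MP.
  apply/mpolyP => x; rewrite mcoeffC; have [->|x0] := eqVneq x 0%MM.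
    by rewrite mulr1.
  by rewrite mulr0; apply: (dhomog_nemf_coeff hv); rewrite mdeg_eq0.
rewrite vC; congr _%:MP; rewrite [in RHS](@pihomog_partitionE _ _ mdeg (msize u).+1 u) //.
rewrite [RHS]raddf_sum big_ord_recl big1 ?addr0 // => i _.
by apply: (@dhomog_nemf_coeff _ _ mdeg (lift ord0 i)); [exact: pihomogP | rewrite mf0].
Qed.

Lemma pihomog_form_divides m d l (p : {mpoly k[m]}) :
  divides (form_poly l) p -> divides (form_poly l) (pihomog mdeg d p).
Proof.
case=> q ->; rewrite (@pihomog_partitionE _ _ mdeg (msize q) q) // mulr_suml raddf_sum /=.
apply: divides_sum => e _; set qe := pihomog mdeg e q.
have hl : form_poly l \is 1.-homog.
  by have := form_prod_homog [:: l]; rewrite /form_prod big_seq1.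
have h : qe * form_poly l \is (e + 1).-homog by apply: dhomogM => //; apply: pihomogP.
have [<-|ne] := eqVneq (e + 1)%N d.
  by rewrite pihomog_dE //; exact/dividesMl/divides_refl.
by rewrite (pihomog_ne0 ne) //; apply: divides0.
Qed.

Lemma log_coeffs_pihomog m (s : seq 'rV[k]_m) r d :
  log_coeffs s r -> log_coeffs s (fun j => pihomog mdeg d (r j)).
Proof.
move=> h l ls; have := pihomog_form_divides d (h l ls); congr divides.
by rewrite /pairing raddf_sum; apply: eq_bigr => j _; rewrite /= linearZ.
Qed.

Lemma log_coeffs_set_row m (s : seq 'rV[k]_m) (M : 'M[{mpoly k[m]}]_m) i r :
  (forall a, log_coeffs s (M a)) -> log_coeffs s r ->
  forall a, log_coeffs s (set_row M i r a).
Proof.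
move=> hM hr a l ls.
rewrite (_ : pairing _ _ = pairing l (if a == i then r else M a)).
  by case: eqP => _; [apply: hr | apply: hM].
by apply: eq_bigr => j _; rewrite mxE; case: eqP.
Qed.

(* [f] divides all the determinants involved, and the quotient is additive in *)
(* the row [i]; hence one summand of the row keeps the constant term nonzero. *)
Lemma exchange_row m n (M : 'M[{mpoly k[m]}]_n) i (K : finType)
    (N : K -> 'I_n -> {mpoly k[m]}) (f u : {mpoly k[m]}) :
  f != 0 -> \det M = u * f -> u@_0%MM != 0 ->
  (forall j, M i j = \sum_d N d j) ->
  (forall d, divides f (\det (set_row M i (N d)))) ->
  exists d u', \det (set_row M i (N d)) = u' * f /\ u'@_0%MM != 0.
Proof.
move=> f0 detM u0 MN /fin_all_exists[v vE].
have uE : u = \sum_d v d.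
  apply: (mulIf f0); rewrite -detM mulr_suml -{1}(set_row_id M i) det_set_row.
  under [RHS]eq_bigr => d _ do rewrite -vE det_set_row.
  rewrite exchange_big; apply: eq_bigr => j _ /=.
  by rewrite MN mulr_suml.
have [d vd0|v0] := pickP (fun d => (v d)@_0%MM != 0).
  by exists d, (v d); rewrite -vE.
case/eqP: u0; rewrite uE raddf_sum big1 // => d _.
by apply/eqP; have := v0 d; case: eqP.
Qed.

(** By [exchange_row] every row can be replaced by one of its homogeneous components while the
    quotient keeps a nonzero constant term. Then the determinant is homogeneous, so it equals its
    only possible nonzero component, the constant term times the product of the forms. *)
Lemma local_saito m (s : seq 'rV[k]_m) (M : 'M[{mpoly k[m]}]_m) u :
  coprime_forms s -> uniq s -> (forall i, log_coeffs s (M i)) ->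
  \det M = u * form_prod s -> u@_0%MM != 0 ->
  exists M', saito_basis s M'.
Proof.
move=> cop us logM detM u0; have [nz _] := cop.
pose f := form_prod s; have f0 : f != 0 by exact: form_prod_neq0.
have step n : (n <= m)%N -> exists (M' : 'M[{mpoly k[m]}]_m) u',
    [/\ forall i, log_coeffs s (M' i), \det M' = u' * f, u'@_0%MM != 0 &
     forall i : 'I_m, (i < n)%N -> exists d, forall j, M' i j \is d.-homog].
  elim: n => [_|n IH nm]; first by exists M, u.
  have [M' [u' [logM' detM' u'0 hom]]] := IH (ltnW nm).
  pose i := Ordinal nm.
  pose K := \max_j msize (M' i j).
  have [||d [v [detN v0]]] := @exchange_row _ _ M' i 'I_K
    (fun d j => pihomog mdeg d (M' i j)) f u' f0 detM' u'0.
  - move=> j; apply: (@pihomog_partitionE _ _ mdeg).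
    exact: (leq_bigmax (F := fun j => msize (M' i j)) j).
  - move=> d; apply: form_prod_divides_det => //; apply: log_coeffs_set_row => //.
    exact/log_coeffs_pihomog/logM'.
  exists (set_row M' i (fun j => pihomog mdeg d (M' i j))), v; split => //.
    by apply: log_coeffs_set_row => //; exact/log_coeffs_pihomog/logM'.
  move=> a; rewrite ltnS leq_eqVlt => /orP[/eqP e|lt].
    have -> : a = i by apply: val_inj.
    by exists d => j; rewrite mxE eqxx; apply: pihomogP.
  have [e he] := hom a lt; exists e => j; rewrite mxE.
  by case: eqP => [ai|_] //; rewrite ai /= ltnn in lt.
have [M' [u' [logM' detM' u'0 hom]]] := step m (leqnn m).
have /fin_all_exists[d dE] : forall i, exists d, forall j, M' i j \is d.-homog.
  by move=> i; apply: hom.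
exists M'; split => //; exists (u'@_0%MM) => //.
have hdet : \det M' \is (\sum_i d i).-homog.
  rewrite /determinant; apply: rpred_sum => t _.
  rewrite -signr_odd mulr_sign.
  suff: \prod_i M' i (t i) \is (\sum_i d i).-homog by case: odd => // ?; rewrite rpredN.
  elim/big_rec2: _ => [|i e p _ hp]; first exact: dhomog1.
  exact: dhomogM.
have hf : f \is (size s).-homog by apply: form_prod_homog.
have comp : pihomog mdeg (size s) (\det M') = u'@_0%MM *: f.
  rewrite detM' {1}(@pihomog_partitionE _ _ mdeg (msize u').+1 u') //.
  rewrite mulr_suml raddf_sum /= big_ord_recl big1 => [|e _].
    by rewrite addr0 pihomog0C mul_mpolyC linearZ /= pihomog_dE.
  apply: (@pihomog_ne0 _ _ mdeg (bump 0 e + size s)%N).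
    by rewrite /bump /= add1n -[X in _ != X]add0n eqn_add2r.
  by apply: dhomogM => //; apply: pihomogP.
rewrite -comp; have [<-|ne] := eqVneq (\sum_i d i)%N (size s).
  by rewrite pihomog_dE.
move: comp; rewrite (pihomog_ne0 ne) // => /esym/eqP.
by rewrite scaler_eq0 (negPf u'0) (negPf f0).
Qed.

End LocalCriterion.

(** * Restriction and extension of the variables *)

Section PrincipalMinor.

Variable R : comNzRingType.

(** Expand along a row outside the image of [h], which is a unit vector. Once [h] is onto, it
    permutes rows and columns alike and the two signs cancel. A general injection, rather than the
    enumeration of a subset, lets the induction delete an index. *)
Lemma det_mxsub_inj m p (h : 'I_p -> 'I_m) (N : 'M[R]_m) : injective h ->
  (forall i j, i \notin codom h -> N i j = (i == j)%:R) ->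
  \det N = \det (mxsub h h N).
Proof.
elim: m p h N => [|m IH] p h N injh hN.
  have e : p = 0%N by apply/eqP; have := leq_card h injh; rewrite !card_ord leqn0.
  by subst p; rewrite !det_mx00.
have [/forallP all|] := boolP [forall i, i \in codom h]; last first.
  case/forallPn => j jh.
  have /fin_all_exists[h' h'E] : forall a, exists b, h a = lift j b.
    move=> a; case: (unliftP j (h a)) => [b ->|e]; first by exists b.
    by case/negP: jh; rewrite -e codom_f.
  have inj' : injective h' by move=> a b e; apply: injh; rewrite !h'E e.
  rewrite (expand_det_row _ j) (bigD1 j) //= big1 => [|b /negPf bj]; last first.
    by rewrite hN // eq_sym bj mul0r.
  rewrite addr0 hN // eqxx mul1r /cofactor addnn -signr_odd odd_double mul1r.
  rewrite (IH _ h') // => [|i b ih].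
    by congr (\det _); apply/matrixP => a b; rewrite !mxE !h'E.
  rewrite !mxE hN ?(inj_eq lift_inj) //; apply: contra ih => /codomP[a].
  by rewrite h'E => /lift_inj->; apply: codom_f.
have e : p = m.+1.
  apply/eqP; rewrite eqn_leq; have := leq_card h injh; rewrite !card_ord => -> /=.
  rewrite -[m.+1]card_ord -[X in (_ <= X)%N]card_ord -(card_codom injh).
  by apply/subset_leq_card/subsetP => i _; apply: all.
subst p; pose s := perm injh.
have -> : mxsub h h N = row_perm s (col_perm s N).
  by apply/matrixP => a b; rewrite !mxE !permE.
by rewrite row_permE col_permE !det_mulmx !det_perm odd_permV mulrCA -signr_addb addbb mulr1.
Qed.

Lemma det_principal_minor m (S : {set 'I_m}) (N : 'M[R]_m) :
  (forall i j, i \notin S -> N i j = (i == j)%:R) ->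
  \det N = \det (mxsub (@enum_val _ (mem S)) (@enum_val _ (mem S)) N).
Proof.
move=> hN; apply: det_mxsub_inj => [|i j ih]; first exact: enum_val_inj.
apply: hN; apply: contra ih => iS; apply/codomP.
by exists (enum_rank_in iS i); rewrite enum_rankK_in.
Qed.

End PrincipalMinor.

Section Restriction.

Variable k : closedFieldType.
Variables (m : nat) (S : {set 'I_m}).

Definition restr (l : 'rV[k]_m) : 'rV[k]_#|S| := \row_i l 0 (enum_val i).

Definition supported (l : 'rV[k]_m) : Prop := forall i, i \notin S -> l 0 i = 0.

Lemma sum_supported (V : zmodType) (F : 'I_m -> V) :
  (forall i, i \notin S -> F i = 0) ->
  \sum_i F i = \sum_(a < #|S|) F (enum_val a).
Proof.
move=> z; rewrite -big_enum_val [RHS]big_mkcond /=; apply: eq_bigr => i _.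
by case: ifPn => // /z.
Qed.

(** The scalar makes one statement serve injectivity ([c = 1]), nonvanishing ([c = 0]) and
    proportionality. *)
Lemma supported_restr_inj l l' c :
  supported l -> supported l' -> restr l' = c *: restr l -> l' = c *: l.
Proof.
move=> sl sl' /rowP e; apply/rowP => i; rewrite mxE.
have [iS|iS] := boolP (i \in S); last by rewrite sl ?sl' // mulr0.
by have := e (enum_rank_in iS i); rewrite !mxE enum_rankK_in.
Qed.

Variable B : {fset 'rV[k]_m}.
Hypothesis arrB : is_arrangement B.
Hypothesis suppB : forall l, l \in B -> supported l.

Definition restrs : {fset 'rV[k]_#|S|} := [fset restr l | l in B].

Lemma restr_inj : {in B &, injective restr}.
Proof.
move=> l l' lB l'B e; apply: esym; rewrite -[RHS]scale1r.
by apply: supported_restr_inj; rewrite ?scale1r //; apply: suppB.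
Qed.

Lemma form_prod_restrs : form_prod restrs = \prod_(l <- B) form_poly (restr l).
Proof. by rewrite /form_prod big_imfset //=; apply: restr_inj. Qed.

Lemma restr_neq0 l : l \in B -> restr l != 0.
Proof.
case: arrB => nz _ lB; apply: contra_neq (nz _ lB) => e.
have := @supported_restr_inj l l 0 (suppB lB) (suppB lB).
by rewrite !scale0r; apply.
Qed.

Lemma restrs_coprime : coprime_forms restrs.
Proof.
split=> [_ /imfsetP[/= l lB ->]|]; first exact: restr_neq0.
move=> _ _ /imfsetP[/= l lB ->] /imfsetP[/= l' l'B ->] d.
have [|||c c0 e] := @subv_hypP _ _ (restr l) (restr l'); rewrite ?restr_neq0 //.
  by rewrite (form_divides_hyp _ _ d) ?restr_neq0.
case: arrB => _ inj; congr restr; apply: inj => //.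
rewrite (supported_restr_inj (suppB lB) (suppB l'B) e).
by rewrite hypZ.
Qed.

(* The coordinates outside [S] are set to their values in [q]; this is only   *)
(* used with [q] vanishing on [S].                                            *)
Definition freeze (q : 'I_m -> k) : {mpoly k[m]} -> {mpoly k[#|S|]} :=
  mmap (@mpolyC #|S| k)
    (fun i => \sum_a (enum_val a == i)%:R *: 'X_a + (q i)%:MP).

HB.instance Definition _ q := GRing.RMorphism.copy (freeze q) (freeze q).

Lemma freezeZ q c p : freeze q (c *: p) = c *: freeze q p.
Proof. by rewrite -!mul_mpolyC rmorphM /= [freeze _ _%:MP]mmapC. Qed.

Lemma freeze_form q l :
  freeze q (form_poly l) = form_poly (restr l) + (\sum_i l 0 i * q i)%:MP.
Proof.
rewrite [in LHS]/form_poly rmorph_sum /= rmorph_sum /=.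
under eq_bigr => i _ do
  rewrite freezeZ [freeze _ _]mmapX mmap1U scalerDr -[_ *: (q i)%:MP]mul_mpolyC -mpolyCM.
rewrite big_split /=; congr (_ + _).
under eq_bigr => i _ do rewrite scaler_sumr.
rewrite exchange_big; apply: eq_bigr => a _ /=.
rewrite (bigD1 (enum_val a)) //= eqxx scale1r big1 ?addr0 ?mxE // => i /negPf e.
by rewrite eq_sym e scale0r scaler0.
Qed.

Lemma pairing_restr n (r : 'I_m -> {mpoly k[n]}) l : supported l ->
  pairing (restr l) (fun b => r (enum_val b)) = pairing l r.
Proof.
move=> sl; rewrite /pairing [RHS]sum_supported; last by move=> i /sl->; rewrite scale0r.
by apply: eq_bigr => a _; rewrite mxE.
Qed.

(** After freezing, the forms of [B] become their restrictions and the remaining forms of [A] get a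
    nonzero constant term. Hence the determinant is $uf$ with $u(0)\neq 0$, but the matrix still has
    [m] rows. For each $j\notin S$ some row is exchanged for the unit vector $e_j$, on which the
    forms of [B] vanish; what remains is the minor on $S$, to which [local_saito] applies. *)
Lemma saito_freeze (A : {fset 'rV[k]_m}) (M : 'M[{mpoly k[m]}]_m) (q : 'I_m -> k) :
  B `<=` A -> saito_basis A M ->
  (forall i, i \in S -> q i = 0) ->
  (forall l, l \in A -> l \notin B -> \sum_i l 0 i * q i != 0) ->
  exists M', saito_basis restrs M'.
Proof.
move=> BA [logM [c c0 detM]] qS qA.
pose f := form_prod restrs.
have f0 : f != 0 by apply: form_prod_neq0; case: restrs_coprime.
pose good (N : 'M[{mpoly k[#|S|]}]_m) :=
  forall i l, l \in B -> divides (form_poly (restr l)) (pairing l (N i)).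
have good_div N : good N -> divides f (\det N).
  move=> gN; apply: form_prod_divides; rewrite ?fset_uniq //; first exact: restrs_coprime.
  move=> _ /imfsetP[/= l lB ->]; apply: (@divides_det_pairing _ _ _ _ l) => [|i].
    by case: arrB => /(_ _ lB).
  exact: gN.
have step n : (n <= m)%N -> exists (N : 'M[{mpoly k[#|S|]}]_m) u,
    [/\ good N, \det N = u * f, u@_0%MM != 0 &
     forall i j : 'I_m, (i < n)%N -> i \notin S -> N i j = (i == j)%:R].
  elim: n => [_|n IH nm].
    have qB l : l \in B -> \sum_i l 0 i * q i = 0.
      move=> lB; rewrite big1 // => i _; have [iS|iS] := boolP (i \in S).
        by rewrite qS // mulr0.
      by rewrite suppB // mul0r.
    exists (map_mx (freeze q) M).
    exists (c *: \prod_(l <- A `\` B) freeze q (form_poly l)).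
    split=> // [i l lB||].
    - have := divides_morph (freeze q) (logM i l (fsubsetP BA _ lB)).
      rewrite /= freeze_form qB // addr0; congr divides.
      rewrite /pairing rmorph_sum; apply: eq_bigr => j _ /=.
      by rewrite freezeZ mxE.
    - rewrite det_map_mx detM /= freezeZ -scalerAl; congr (_ *: _).
      rewrite /f form_prod_restrs /form_prod rmorph_prod /= mulrC.
      rewrite (@big_fsetID _ _ _ _ (mem B) A) /=; congr (_ * _).
        rewrite (_ : [fset x in A | x \in B] = B); last first.
          by apply/fsetP => l; rewrite !inE /=; apply: andb_idl; apply/fsubsetP.
        by apply: eq_big_seq => l lB; rewrite freeze_form qB // addr0.
      by apply: eq_fbigl => l; rewrite !inE /= andbC.
    - rewrite mcoeffZ mulf_neq0 // rmorph_prod /= prodf_seq_neq0; apply/allP => l.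
      rewrite !inE => /andP[lB lA]; rewrite /= freeze_form mcoeffD mpolyCK.
      rewrite (_ : (form_poly (restr l))@_0 = 0) ?add0r ?qA //.
      rewrite /form_poly raddf_sum big1 // => j _ /=.
      by rewrite mcoeffZ mcoeffX mnm1_eq0 mulr0.
  have [N [u [gN detN u0 hN]]] := IH (ltnW nm).
  pose j := Ordinal nm; have [jS|jS] := boolP (j \in S).
    exists N, u; split => // a b; rewrite ltnS leq_eqVlt => /orP[/eqP e|]; last exact: hN.
    by rewrite (_ : a = j) ?jS //; apply: val_inj.
  pose ej (b : 'I_m) : {mpoly k[#|S|]} := (j == b)%:R.
  have ejB l : l \in B -> pairing l ej = 0.
    move=> lB; rewrite /pairing (bigD1 j) //= suppB // scale0r add0r big1 // => b.
    by rewrite /ej eq_sym => /negPf->; rewrite scaler0.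
  have gset i : good (set_row N i ej).
    move=> a l lB; rewrite (_ : pairing _ _ = pairing l (if a == i then ej else N a)).
      by case: eqP => _; [rewrite ejB //; apply: divides0 | apply: gN].
    by apply: eq_bigr => b _; rewrite mxE; case: eqP.
  have /fin_all_exists[v vE] := fun i => good_div _ (gset i).
  (* Expansion along column [j]: the cofactor of row [i] is the determinant with that row replaced
     by $e_j$. As [u] is nonzero at the origin, so is one of the summands. *)
  have uE : u = \sum_i N i j * v i.
    apply: (mulIf f0); rewrite -detN (expand_det_col _ j) mulr_suml.
    apply: eq_bigr => i _; rewrite -mulrA -vE det_set_row (bigD1 j) //= /ej eqxx mul1r.
    by rewrite big1 ?addr0 // => b; rewrite eq_sym => /negPf->; rewrite mul0r.
  have [i vi] : exists i, (N i j * v i)@_0%MM != 0.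
    apply/existsP; apply: contraNT u0; rewrite negb_exists => /forallP h.
    by rewrite uE raddf_sum big1 // => i _; apply/eqP; have := h i; rewrite negbK.
  rewrite rmorphM mulf_eq0 negb_or /= in vi; case/andP: vi => Nij vi.
  (* Rows exchanged earlier are unit vectors with entry 0 in column [j], so the new exchange does
     not destroy them. *)
  have iN (a : 'I_m) : (a < n)%N -> a \notin S -> a != i.
    move=> an aS; apply: contraNneq Nij => <-; rewrite hN //.
    by rewrite -val_eqE /= ltn_eqF // mcoeff0.
  exists (xrow i j (set_row N i ej)), ((-1) ^+ (i != j) * v i); split.
  - move=> a l lB; have := gset i (tperm i j a) l lB; congr divides.
    by apply: eq_bigr => b _; rewrite !mxE.
  - by rewrite -mulrA -vE xrowE det_mulmx det_perm odd_tperm.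
  - by case: (i != j); rewrite ?expr0 ?mul1r // expr1 mulN1r mcoeffN oppr_eq0.
  move=> a b; rewrite ltnS leq_eqVlt => /orP[/eqP e|lt] aS; rewrite !mxE.
    have -> : a = j by apply: val_inj.
    by rewrite tpermR eqxx.
  have ai := iN a lt aS; have aj : a != j by rewrite -val_eqE /= ltn_eqF.
  have -> : tperm i j a = a by rewrite tpermD // eq_sym.
  by rewrite (negPf ai) hN.
have [N [u [gN detN u0 hN]]] := step m (leqnn m).
apply: (@local_saito _ _ restrs (mxsub (@enum_val _ (mem S)) (@enum_val _ (mem S)) N) u) => //.
- exact: restrs_coprime.
- exact: fset_uniq.
- move=> a _ /imfsetP[/= l lB ->]; have := gN (enum_val a) l lB; congr divides.
  rewrite -pairing_restr; last exact: suppB.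
  by apply: eq_bigr => b _; congr (_ *: _); rewrite mxE.
- by rewrite -det_principal_minor // => i j iS; apply: hN.
Qed.

Definition extend : {mpoly k[#|S|]} -> {mpoly k[m]} :=
  mmap (@mpolyC m k) (fun a => 'X_(enum_val a)).

HB.instance Definition _ := GRing.RMorphism.copy extend extend.

Lemma extendZ c p : extend (c *: p) = c *: extend p.
Proof. by rewrite -!mul_mpolyC rmorphM /= [extend _%:MP]mmapC. Qed.

Lemma extend_form l : supported l -> extend (form_poly (restr l)) = form_poly l.
Proof.
move=> sl; rewrite {2}/form_poly sum_supported; last by move=> i /sl->; rewrite scale0r.
rewrite [in LHS]/form_poly rmorph_sum; apply: eq_bigr => a _ /=.
by rewrite extendZ [extend _]mmapX mmap1U mxE.
Qed.

(** The matrix is block diagonal: [M] on $S$ and the identity elsewhere. The double sum below has at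
    most one nonzero term and avoids choosing positions of [i] and [j] in $S$. *)
Lemma saito_extend (M : 'M[{mpoly k[#|S|]}]_#|S|) : saito_basis restrs M ->
  exists N, [/\ saito_basis B N,
    forall i j, i \notin S -> N i j = (i == j)%:R &
    forall i j, i \in S -> j \notin S -> N i j = 0].
Proof.
move=> [logM [c c0 detM]].
pose N : 'M[{mpoly k[m]}]_m := \matrix_(i, j)
  (\sum_a \sum_b (if (enum_val a == i) && (enum_val b == j) then extend (M a b) else 0)
   + ((i \notin S) && (i == j))%:R).
have NS a b : N (enum_val a) (enum_val b) = extend (M a b).
  rewrite mxE enum_valP /= addr0 (bigD1 a) //= (bigD1 b) //= !eqxx /=.
  rewrite !big1 ?addr0 //.
    move=> i /negPf ia; rewrite big1 // => j _.
    by rewrite (inj_eq enum_val_inj) ia.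
  by move=> j /negPf jb; rewrite !(inj_eq enum_val_inj) jb ?andbF.
have Nout i j : i \notin S -> N i j = (i == j)%:R.
  move=> iS; rewrite mxE iS /= [X in X + _]big1 ?add0r // => a _; rewrite big1 // => b _.
  by case: eqP => //= e; case/negP: iS; rewrite -e enum_valP.
exists N; split => //; last first.
  move=> i j iS jS; rewrite mxE iS /= addr0 big1 // => a _; rewrite big1 // => b _.
  case: (enum_val b =P j) => [e|_]; last by rewrite andbF.
  by case/negP: jS; rewrite -e enum_valP.
split; last first.
  exists c => //; rewrite (@det_principal_minor _ _ S) //.
  rewrite (_ : mxsub _ _ N = map_mx extend M); last first.
    by apply/matrixP => a b; rewrite mxE NS mxE.
  rewrite det_map_mx detM /= extendZ form_prod_restrs rmorph_prod /form_prod;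
    congr (_ *: _).
  by apply: eq_big_seq => l lB; apply: extend_form; apply: suppB.
move=> i l lB; have [iS|iS] := boolP (i \in S); last first.
  rewrite (_ : pairing _ _ = 0); first exact: divides0.
  rewrite /pairing big1 // => j _; rewrite Nout //.
  by case: eqP => [<-|_]; rewrite ?scaler0 // suppB // scale0r.
pose a := enum_rank_in iS i.
have rl : restr l \in restrs by apply/imfsetP; exists l.
have := divides_morph extend (logM a (restr l) rl).
rewrite /= extend_form; last exact: suppB.
congr divides; rewrite -[RHS]pairing_restr; last exact: suppB.
rewrite /pairing rmorph_sum; apply: eq_bigr => b _ /=.
by rewrite extendZ -NS /a enum_rankK_in.
Qed.

End Restriction.

(** * Elimination orders of chordal graphs *)

Section ChordalGraphs.

Variables (T : finType) (G : sgraph T).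
Hypothesis chordalG : chordal G.
Local Notation e := (edge G).

Let eC x y : e x y = e y x. Proof. exact: edge_sym. Qed.

Lemma next_split (q1 q2 : seq T) x y :
  uniq (q1 ++ x :: y :: q2) -> next (q1 ++ x :: y :: q2) x = y.
Proof.
by move=> uc; rewrite -(next_rot (size q1) uc) rot_size_cat /= eqxx.
Qed.

(** The vertex [v] closes the path into a cycle and sees only its two ends. A chord of this cycle
    therefore does not meet [v]; it cuts the path short, and induction on the length ends with a
    single edge. *)
Lemma chordal_shortcut v s p :
  path e s p -> uniq (v :: s :: p) -> e v s -> e v (last s p) ->
  s != last s p -> (forall x, x \in p -> e v x -> x = last s p) ->
  e s (last s p).
Proof.
have [n] := ubnP (size p); elim: n p => // n IH p; rewrite ltnS => szp.
move=> pp uc vs vt st int; set c := v :: s :: p in uc.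
have [|sz1] := leqP (size p) 1.
  case: p pp st {IH szp uc vt int c} => [|y [|//]] /=; first by rewrite eqxx.
  by rewrite andbT.
have cyc : ucycle e c.
  by rewrite /ucycle uc andbT /= rcons_path vs pp eC.
have [x [y [xc yc exy ny nx]]] := chordalG cyc (sz1 : (3 < size c)%N).
have shortcut a b p1 p2 : p = p1 ++ p2 -> a = last s p1 -> b \in p2 ->
    e a b -> b != next c a -> e s (last s p).
  move=> pE aE bp2 eab nb; case/splitPr: bp2 pE => p3 p4 pE.
  have p30 : (0 < size p3)%N.
    case: p3 pE => // pE; case/eqP: nb; apply: esym.
    have cE : c = belast v (s :: p1) ++ a :: b :: p4.
      have E : v :: s :: p1 = rcons (belast v (s :: p1)) a by rewrite aE lastI.
      by rewrite /c pE -cat_cons -cat_cons E cat_rcons.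
    by rewrite cE in uc *; apply: next_split.
  have lastE : last s (p1 ++ b :: p4) = last s p.
    by rewrite pE !last_cat.
  have sub : subseq (p1 ++ b :: p4) p.
    by rewrite pE; apply: cat_subseq => //; apply: suffix_subseq.
  rewrite -lastE; apply: IH; rewrite ?lastE //.
  - move: szp; rewrite pE !size_cat; apply: leq_trans.
    by rewrite ltn_add2l -[X in (X < _)%N]add0n ltn_add2r.
  - move: pp; rewrite pE !cat_path /= -aE eab => /and3P[-> _].
    by case/andP.
  - by apply: subseq_uniq uc; rewrite /= !eqxx.
  - by move=> z /(mem_subseq sub); apply: int.
have noV y0 : y0 \in s :: p -> e v y0 -> y0 != next c v -> v != next c y0 -> False.
  rewrite inE => /orP[/eqP-> _|yp vy _].
    by rewrite (@next_split [::] p v s uc) eqxx.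
  rewrite (int _ yp vy) => /eqP; apply; apply: esym.
  have cE : c = rcons (belast v (s :: p)) (last s p) by rewrite /c lastI.
  rewrite -(next_rot (size (belast v (s :: p))) uc) {1}cE -cats1 rot_size_cat /=.
  by rewrite eqxx.
move: xc; rewrite inE => /orP[/eqP xv|xp].
  move: yc; rewrite inE => /orP[/eqP yv|yp].
    by move: exy; rewrite xv yv edge_irr.
  by rewrite xv in exy ny nx; case: (noV y).
move: yc; rewrite inE => /orP[/eqP yv|yp].
  by rewrite yv eC in exy; rewrite yv in ny nx; case: (noV x).
(* The ends of the chord may occur along the path in either order. *)
have shortcut2 a b : a \in s :: p -> b \in s :: p -> e a b ->
    b != next c a -> a != next c b -> e s (last s p).
  move=> ap bp eab nb na.
  have [p1 [p2 [pE aE]]] : exists p1 p2, p = p1 ++ p2 /\ last s p1 = a.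
    by case/splitPl: ap => p1 p2 aE; exists p1, p2.
  rewrite pE in bp; move: bp; rewrite -cat_cons mem_cat => /orP[bp1|bp2]; last first.
    exact: (shortcut a b p1 p2 pE (esym aE)).
  case/splitPl: bp1 aE pE => p3 p4 bE aE pE.
  apply: (shortcut b a p3 (p4 ++ p2)); rewrite ?catA // 1?eC // mem_cat.
  have lb : last b p4 = a by rewrite -bE -last_cat.
  have := mem_last b p4; rewrite lb inE => /orP[/eqP ab|->//].
  by move: eab; rewrite ab edge_irr.
exact: (shortcut2 x y).
Qed.

Definition simplicial (U : {set T}) z :=
  {in U &, forall a b, e z a -> e z b -> a != b -> e a b}.

(** Dirac's argument. Let [C] be the component of [z0] among the non-neighbours of [v], and [S] the
    neighbours of [v] attached to [C]. Then [S] is a clique, and vertices of [C] have all their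
    neighbours in $C\cup S$, so one that is simplicial there is simplicial in [U]. Induction applies
    to $C\cup S$, which omits [v]. Prescribing non-adjacency to [v] is what keeps the vertex found
    by induction out of [S]. *)
Lemma simplicial_nonadjacent (U : {set T}) v z0 :
  v \in U -> z0 \in U -> z0 != v -> ~~ e v z0 ->
  exists z, [/\ z \in U, z != v, ~~ e v z & simplicial U z].
Proof.
have [n] := ubnP #|U|; elim: n U v z0 => // n IH U v z0; rewrite ltnS => szU.
move=> vU z0U z0v nz0.
pose F := [set z in U | (z != v) && ~~ e v z].
pose r a b := [&& e a b, a \in F & b \in F].
have rC : connect_sym r.
  by apply: sym_connect_sym => a b; rewrite /r eC [(a \in F) && _]andbC.
have z0F : z0 \in F by rewrite inE z0U z0v nz0.
pose C := [set z | connect r z0 z].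
have CF : {subset C <= F}.
  move=> z; rewrite inE => /connectP[p]; elim/last_ind: p z => [|p x _] z.
    by move=> _ ->.
  by rewrite rcons_path last_rcons => /andP[_ /and3P[_ _ xF]] ->.
pose S := [set s in U | e v s && [exists c in C, e s c]].
have z0C : z0 \in C by rewrite inE connect0.
have nbr c a : c \in C -> a \in U -> e c a -> a \in C :|: S.
  move=> cC aU eca; have := CF _ cC; rewrite inE => /and3P[cU cv nvc].
  rewrite inE; have [eva|nva] := boolP (e v a).
    apply/orP; right; rewrite inE aU eva /=; apply/existsP; exists c.
    by rewrite cC eC.
  have aF : a \in F.
    rewrite inE aU nva andbT; apply: contraNneq nvc => av.
    by rewrite -av eC.
  apply/orP; left; move: (cC); rewrite !inE => /connect_trans; apply.
  by apply: connect1; rewrite /r eca aF andbT; apply: CF.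
have SU s : s \in S -> s \in U by rewrite inE => /andP[].
(* Two vertices of [S] are joined by a path through [C], whose inner vertices are not adjacent to
   [v]; [chordal_shortcut] shrinks it to an edge. *)
have cliqueS : {in S &, forall s t, s != t -> e s t}.
  move=> s t; rewrite !inE => /and3P[sU vs /existsP[c1 /andP[c1C sc1]]].
  move=> /and3P[tU vt /existsP[c2 /andP[c2C tc2]]] st.
  have : connect r c1 c2.
    by move: c1C c2C; rewrite !inE rC => /connect_trans; apply.
  case/connectP => p rp c2E.
  have pF x : x \in c1 :: p -> x \in F.
    move=> xp; apply: CF; rewrite inE; move: c1C; rewrite inE => /connect_trans; apply.
    by case/splitPl: xp rp => p1 p2 <-; rewrite cat_path => /andP[rp1 _];
      apply/connectP; exists p1.
  have ep : path e s (rcons (c1 :: p) t).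
    rewrite rcons_path /= sc1 -c2E eC tc2 andbT.
    by apply: sub_path rp => a b /andP[].
  have := last_rcons s (c1 :: p) t.
  case/shortenP: ep => p' ep' up' sub lastE.
  rewrite -lastE; apply: (chordal_shortcut (v := v)); rewrite ?lastE //.
    rewrite cons_uniq up' andbT inE negb_or.
    rewrite (contraTneq _ vs) => [|->]; last by rewrite edge_irr.
    apply/negP => /sub; rewrite mem_rcons inE => /orP[/eqP vt'|/pF].
      by move: vt; rewrite vt' edge_irr.
    by rewrite inE eqxx /= andbF.
  move=> x /sub; rewrite mem_rcons inE => /orP[/eqP //|/pF].
  by rewrite inE => /and3P[_ _ /negPf->].
have szH : (#|C :|: S| < n)%N.
  apply: leq_trans szU; apply: proper_card; apply/properP; split.
    apply/subsetP => a; rewrite inE => /orP[/CF|/SU//].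
    by rewrite inE => /andP[].
  exists v => //; rewrite inE negb_or; apply/andP; split.
    by apply/negP => /CF; rewrite inE eqxx /= andbF.
  by rewrite inE edge_irr andbF.
have simpU z : z \in C -> simplicial (C :|: S) z -> simplicial U z.
  by move=> zC sz a b aU bU za zb; apply: sz => //; apply: nbr zC _ _.
have found z : z \in C -> simplicial (C :|: S) z ->
    exists z, [/\ z \in U, z != v, ~~ e v z & simplicial U z].
  move=> zC sz; exists z; have := CF _ zC; rewrite inE => /and3P[-> -> ->].
  by split=> //; apply: simpU.
(* If [a] sees all of [S] but misses some vertex of $C\cup S$, the simplicial vertex not adjacent to
   [a] given by induction must lie in [C]. Otherwise [a] sees everything; if this holds for all
   vertices, $C\cup S$ is a clique and [z0] itself works. *)
have universal a : a \in C :|: S -> (forall b, b \in S -> b != a -> e b a) ->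
    (exists z, [/\ z \in U, z != v, ~~ e v z & simplicial U z]) \/
    (forall z, z \in C :|: S -> z != a -> e a z).
  move=> aH aS; have [/existsP[z /and3P[zH za naz]]|] :=
    boolP [exists z, [&& z \in C :|: S, z != a & ~~ e a z]]; last first.
    rewrite negb_exists => /forallP h; right=> z zH za.
    by have := h z; rewrite zH za negbK.
  left; have [x [xH xa nax sx]] := IH _ _ _ szH aH zH za naz.
  apply: (found x) => //; move: xH; rewrite inE => /orP[//|xS].
  by case/negP: nax; rewrite eC; apply: aS.
have [/existsP[s /andP[sS /existsP[z /and3P[zH zs nsz]]]]|] :=
    boolP [exists s in S, [exists z, [&& z \in C :|: S, z != s & ~~ e s z]]].
  have [] // := universal s.
  - by rewrite inE sS orbT.
  - by move=> b bS bs; apply: cliqueS.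
  - by move=> /(_ z zH zs) h; rewrite h in nsz.
rewrite negb_exists => /forallP hS.
have {}hS s z : s \in S -> z \in C :|: S -> z != s -> e s z.
  move=> sS zH zs; have := hS s; rewrite sS /= negb_exists => /forallP/(_ z).
  by rewrite zH zs negbK.
have [/existsP[c /andP[cC /existsP[z /and3P[zH zc ncz]]]]|] :=
    boolP [exists c in C, [exists z, [&& z \in C :|: S, z != c & ~~ e c z]]].
  have cH : c \in C :|: S by rewrite inE cC.
  have [] // := universal c cH.
  - by move=> b bS bc; apply: hS; rewrite // eq_sym.
  - by move=> /(_ z zH zc) h; rewrite h in ncz.
rewrite negb_exists => /forallP hC; apply: (found z0) => // a b aH bH _ _ ab.
move: (aH); rewrite inE => /orP[aC|aS]; last by apply: hS; rewrite // eq_sym.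
have := hC a; rewrite aC /= negb_exists => /forallP/(_ b).
by rewrite bH [b == a]eq_sym ab negbK.
Qed.

(** A simplicial vertex is placed last and the rest is ordered by induction; the bound on the ranks
    leaves the top value for that vertex. If no two vertices are non-adjacent, any vertex is
    simplicial. *)
Lemma chordal_elimination : exists r : T -> nat, injective r /\
  forall v a b, e v a -> e v b -> (r a < r v)%N -> (r b < r v)%N -> a != b -> e a b.
Proof.
suff [r [rU inj elim]] : exists r : T -> nat,
    [/\ forall x, x \in [set: T] -> (r x < #|[set: T]|)%N,
    {in [set: T] &, injective r} &
    forall v a b, v \in [set: T] -> a \in [set: T] -> b \in [set: T] -> e v a -> e v b ->
      (r a < r v)%N -> (r b < r v)%N -> a != b -> e a b].
  exists r; split=> [x y|v a b]; first by apply: inj; rewrite inE.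
  by apply: elim; rewrite inE.
have [n] := ubnP #|[set: T]|; elim: n [set: T] => // n IH U; rewrite ltnS => szU.
have [U0|[v vU]] := set_0Vmem U.
  by exists (fun _ => 0%N); split=> [x|x y|x a b]; rewrite U0 inE.
have [z [zU sz]] : exists z, z \in U /\ simplicial U z.
  have [/existsP[a /andP[aU /existsP[b /and3P[bU ba nab]]]]|] :=
    boolP [exists a in U, [exists b, [&& b \in U, b != a & ~~ e a b]]].
    by have [z [zU _ _ sz]] := simplicial_nonadjacent aU bU ba nab; exists z.
  rewrite negb_exists => /forallP h; exists v; split=> // a b aU bU _ _ ab.
  have := h a; rewrite aU /= negb_exists => /forallP/(_ b).
  by rewrite bU [b == a]eq_sym ab negbK.
have cardU : #|U| = #|U :\ z|.+1 by rewrite (cardsD1 z) zU.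
have [|r [rU inj elim]] := IH (U :\ z); first by rewrite -cardU.
exists (fun x => if x == z then #|U :\ z| else r x); split.
- move=> x xU; rewrite cardU ltnS; case: eqP => // /eqP xz.
  by apply/ltnW/rU; rewrite !inE xz.
- move=> x y xU yU /=; case: (eqVneq x z) => [->|xz]; case: (eqVneq y z) => [->|yz] //.
  + by move=> E; have := rU y; rewrite !inE yz yU -E ltnn => /(_ isT).
  + by move=> E; have := rU x; rewrite !inE xz xU E ltnn => /(_ isT).
  + by apply: inj; rewrite !inE ?xz ?yz.
- move=> x a b xU aU bU xa xb.
  case: (eqVneq x z) => [xE|xz]; first by rewrite xE in xa xb; move=> _ _; apply: sz.
  have nz y : y \in U -> ((if y == z then #|U :\ z| else r y) < r x)%N ->
      y \in U :\ z /\ (r y < r x)%N.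
    move=> yU; rewrite !inE yU; case: eqP => //= _.
    by move=> E; have := rU x; rewrite !inE xz xU ltnNge ltnW // => /(_ isT).
  move=> /(nz a aU)[aU' ax] /(nz b bU)[bU' bx].
  by apply: (elim x); rewrite // !inE xz.
Qed.

End ChordalGraphs.

(** * Bases from elimination orders *)

Section GraphicForms.

Variable k : closedFieldType.
Variables (m : nat) (D : {fset 'rV[k]_m}) (w : 'I_m -> k).
Hypothesis arrD : is_arrangement D.
Hypothesis w0 : forall i, w i != 0.
Hypothesis suppD : forall l, l \in D -> #|supp l| = 2%N.
Hypothesis sumD : forall l, l \in D -> \sum_i l 0 i * w i = 0.

Local Notation e := (supp_edge D).

Definition ycoord (i : 'I_m) : {mpoly k[m]} := (w i)^-1 *: 'X_i.

Lemma in_supp (l : 'rV[k]_m) i : (i \in supp l) = (l 0 i != 0).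
Proof. by rewrite inE. Qed.

Lemma sum_supp2 (V : lmodType k) (l : 'rV[k]_m) i j (F : 'I_m -> V) :
  i != j -> supp l = [set i; j] ->
  \sum_a l 0 a *: F a = l 0 i *: F i + l 0 j *: F j.
Proof.
move=> ij sl; rewrite (bigD1 i) //= (bigD1 j) 1?eq_sym //= big1 ?addr0 // => a.
move=> /andP[ai aj]; have : a \notin supp l by rewrite sl !inE negb_or ai.
by rewrite in_supp negbK => /eqP->; rewrite scale0r.
Qed.

Lemma supp2_weight l i j : l \in D -> i != j -> supp l = [set i; j] ->
  l 0 j * w j = - (l 0 i * w i).
Proof.
move=> lD ij sl; apply/eqP; rewrite -addr_eq0 addrC.
by rewrite -[_ * _ + _](@sum_supp2 k^o _ _ _ w ij sl) sumD.
Qed.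

Lemma pairing_supp2 n (r : 'I_m -> {mpoly k[n]}) l i j :
  l \in D -> i != j -> supp l = [set i; j] ->
  pairing l r = (l 0 i * w i) *: ((w i)^-1 *: r i - (w j)^-1 *: r j).
Proof.
move=> lD ij sl; rewrite /pairing (sum_supp2 _ ij sl) scalerBr !scalerA mulfK //.
by rewrite -scaleNr -mulNr -(supp2_weight lD ij sl) mulfK.
Qed.

Lemma form_supp2 l i j : l \in D -> i != j -> supp l = [set i; j] ->
  form_poly l = (l 0 i * w i) *: (ycoord i - ycoord j).
Proof. exact: pairing_supp2. Qed.

(** Vanishing at [w] fixes the ratio of the two coefficients, so every edge comes from a single
    hyperplane. *)
Lemma supp_eq l l' : l \in D -> l' \in D -> supp l = supp l' -> l = l'.
Proof.
move=> lD l'D sE; have /eqP/cards2P[i [j [ij sl]]] := suppD lD.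
case: arrD => _ inj; apply: (inj l l' lD l'D).
have li : l 0 i != 0 by rewrite -in_supp sl !inE eqxx.
have l'i : l' 0 i != 0 by rewrite -in_supp -sE sl !inE eqxx.
have -> : l' = (l' 0 i / l 0 i) *: l; last by apply: esym; apply: hypZ;
  rewrite mulf_neq0 ?invr_eq0.
have sl' : supp l' = [set i; j] by rewrite -sE.
apply/rowP => a; rewrite mxE; have [->|ai] := eqVneq a i; first by rewrite divfK.
have [->|aj] := eqVneq a j.
  apply: (mulIf (w0 j)); rewrite -[RHS]mulrA (supp2_weight lD ij sl).
  by rewrite (supp2_weight l'D ij sl') mulrN mulrA divfK.
have : a \notin supp l by rewrite sl !inE negb_or ai.
have : a \notin supp l' by rewrite sl' !inE negb_or ai.
by rewrite !in_supp !negbK => /eqP-> /eqP->; rewrite mulr0.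
Qed.

Lemma edge_supp2 l i j : l \in D -> i != j -> supp l = [set i; j] -> e i j.
Proof. by move=> lD ij sl; rewrite /supp_edge ij; apply/hasP; exists l; rewrite ?sl. Qed.

Lemma edge_formP i j : reflect (exists2 l, l \in D & i != j /\ supp l = [set i; j]) (e i j).
Proof.
apply: (iffP andP) => [[ij /hasP[l lD /eqP sl]]|[l lD [ij sl]]]; first by exists l.
by split => //; apply/hasP; exists l; rewrite ?sl.
Qed.

Section Elimination.

Variable r : 'I_m -> nat.
Hypothesis r_inj : injective r.
Hypothesis r_elim : forall v a b, e v a -> e v b ->
  (r a < r v)%N -> (r b < r v)%N -> a != b -> e a b.

Definition lower v u := e v u && (r u < r v)%N.

Definition above (v : 'I_m) : pred 'I_m :=
  connect (fun a b => e a b && (r a < r b)%N) v.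

(** The factor [w x] converts the derivative of the rescaled coordinate $y_x = x_x/w_x$ into that of
    $x_x$. By reflexivity, [above v] contains [v]. *)
Definition graph_basis : 'M[{mpoly k[m]}]_m := \matrix_(v, x)
  if above v x then w x *: \prod_(u | lower v u) (ycoord x - ycoord u) else 0.

Lemma above_rank v x : above v x -> v != x -> (r v < r x)%N.
Proof.
case/connectP => p; elim/last_ind: p x => [|p y IH] x /=; first by move=> _ ->;
  rewrite eqxx.
rewrite rcons_path last_rcons => /andP[pp /andP[_ lt]] -> _.
have [->//|ne] := eqVneq v (last v p).
by apply: ltn_trans lt; apply: IH.
Qed.

(** Let [a] precede [x] on an increasing path from [v]. Then [a] and [y] are earlier neighbours of
    [x], hence equal or adjacent: if [y] comes after [a] it is reached through [a], and otherwise
    the argument repeats with [a] in place of [x]. *)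
Lemma above_lower v x y : above v x -> e x y -> (r y < r x)%N ->
  above v y || lower v y.
Proof.
case/connectP => p; elim/last_ind: p x => [|p z IH] x /=.
  by move=> _ -> vy ry; rewrite /lower vy ry orbT.
rewrite rcons_path last_rcons => /andP[pp /andP[ea lt]] -> zy ry.
set a := last v p in ea lt *.
have va : above v a by apply/connectP; exists p.
have [<-|ay] := eqVneq a y; first by rewrite va.
have eay : e a y by apply: (r_elim (v := z)); rewrite // supp_edge_sym.
case: (ltngtP (r a) (r y)) => [lay|lya|/r_inj E].
- apply/orP; left; apply: connect_trans va _; apply: connect1.
  by rewrite eay.
- exact: (IH a).
- by rewrite E eqxx in ay.
Qed.

Lemma divides_prodB (R : comNzRingType) (I : finType) (P : pred I) (c : I -> R) x y :
  divides (x - y) (\prod_(i | P i) (x - c i) - \prod_(i | P i) (y - c i)).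
Proof.
elim/big_rec2: _ => [|i p q _ h]; first by rewrite subrr; apply: divides0.
rewrite (_ : (x - c i) * _ - _ = (x - y) * q + (y - c i) * (q - p)); last by ring.
apply: dividesD; first exact/dividesMr/divides_refl.
exact: dividesMl.
Qed.

(** Take an edge with [i] before [j]. If [i] is above [v], so is [j], and one polynomial is
    evaluated at $y_i$ and at $y_j$. If only [j] is above [v], then [i] is an earlier neighbour of
    [v] by [above_lower], so $y_j - y_i$ is a factor of the entry. *)
Lemma graph_basis_log v : log_coeffs D (graph_basis v).
Proof.
move=> l lD; have /eqP/cards2P[i [j [ij sl]]] := suppD lD.
wlog lt : i j ij sl / (r i < r j)%N.
  move=> H; case: (ltngtP (r i) (r j)) => [|lt|/r_inj E].
  - exact: H.
  - by apply: (H j i); rewrite // 1?eq_sym // setUC.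
  - by rewrite E eqxx in ij.
have eij := edge_supp2 lD ij sl.
rewrite (pairing_supp2 _ lD ij sl) (form_supp2 lD ij sl) !mxE.
suff [q ->] : divides (ycoord i - ycoord j)
   ((w i)^-1 *: (if above v i then w i *: \prod_(u | lower v u) (ycoord i - ycoord u) else 0)
   - (w j)^-1 *: (if above v j then w j *: \prod_(u | lower v u) (ycoord j - ycoord u) else 0)).
  by exists q; rewrite scalerAr.
case: ifPn => vi.
  rewrite ifT; last by apply: connect_trans vi _; apply: connect1; rewrite eij.
  by rewrite !scalerA !mulVf // !scale1r; apply: divides_prodB.
case: ifPn => vj; last by rewrite !scaler0 subr0; apply: divides0.
have := above_lower vj; move/(_ i);
  rewrite supp_edge_sym eij lt (negPf vi) => /(_ isT isT) low.
rewrite scaler0 sub0r scalerA mulVf // scale1r (bigD1 i) //= -mulNr opprB.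
exact/dividesMr/divides_refl.
Qed.

(** The matrix is triangular for [r], and its diagonal runs through the pairs formed by a vertex and
    an earlier neighbour, that is, through each edge once. *)
Lemma det_graph_basis :
  exists2 c, c != 0 & \det graph_basis = c *: form_prod D.
Proof.
pose cond (p : 'I_m * 'I_m) := lower p.1 p.2.
pose L (p : 'I_m * 'I_m) := nth 0 D (find (fun l => supp l == [set p.1; p.2]) D).
have LD p : cond p -> [/\ p.1 != p.2, L p \in D & supp (L p) = [set p.1; p.2]].
  move=> /andP[/andP[ne hasl] _]; split => //; first by rewrite mem_nth // -has_find.
  exact/eqP/(nth_find 0 hasl).
pose s := [seq L p | p <- index_enum ('I_m * 'I_m)%type & cond p].
have Ds : perm_eq D s.
  apply: uniq_perm; first exact: fset_uniq.
    rewrite map_inj_in_uniq ?filter_uniq ?index_enum_uniq //.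
    move=> [v u] [v' u']; rewrite !mem_filter => /andP[cp _] /andP[cp' _] E.
    have [/= ne _ sE] := LD _ cp; have [/= ne' _ sE'] := LD _ cp'.
    have /andP[_ lt] := cp; have /andP[_ lt'] := cp'; rewrite /= in lt lt'.
    rewrite E sE' in sE.
    have : v' \in [set v; u] by rewrite -sE !inE eqxx.
    have : u' \in [set v; u] by rewrite -sE !inE eqxx orbT.
    have : v \in [set v'; u'] by rewrite sE !inE eqxx.
    rewrite !inE => /orP[/eqP ->|/eqP vu'].
      by rewrite [u' == v']eq_sym (negPf ne') => /eqP->.
    rewrite vu' in lt ne *; move=> _ /orP[/eqP E'|/eqP E'].
      by rewrite E' eqxx in ne'.
    by rewrite E' in lt'; have := ltn_trans lt lt'; rewrite ltnn.
  move=> l; apply/idP/mapP => [lD|[p]]; last first.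
    by rewrite mem_filter => /andP[/LD[_ lD _] _] ->.
  have /eqP/cards2P[i [j [ij sl]]] := suppD lD.
  wlog lt : i j ij sl / (r i < r j)%N.
    move=> H; case: (ltngtP (r i) (r j)) => [|lt|/r_inj E].
    - exact: H.
    - by apply: (H j i); rewrite // 1?eq_sym // setUC.
    - by rewrite E eqxx in ij.
  have cp : cond (j, i).
    by rewrite /cond /lower /= lt andbT supp_edge_sym (edge_supp2 lD).
  exists (j, i); first by rewrite mem_filter cp mem_index_enum.
  by have [_ L1 L2] := LD _ cp; apply: supp_eq => //; rewrite L2 sl setUC.
pose c p := L p 0 p.1 * w p.1.
have c0 p : cond p -> c p != 0.
  move=> /LD[_ _ sE]; rewrite mulf_neq0 // -in_supp sE.
  by rewrite !inE eqxx.
have fE : form_prod D =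
    (\prod_(p | cond p) c p) *: \prod_(p | cond p) (ycoord p.1 - ycoord p.2).
  rewrite /form_prod (perm_big _ Ds) big_map big_filter -scaler_prod.
  by apply: eq_bigr => p /LD[ne lD sE]; rewrite -form_supp2.
have P0 : \prod_(p | cond p) c p != 0 by apply/prodf_neq0.
exists ((\prod_v w v) / \prod_(p | cond p) c p).
  by rewrite mulf_neq0 ?invr_eq0 //; apply/prodf_neq0.
rewrite fE scalerA divfK // (det_triangular_rank (r := r)); last first.
  by move=> v x vx; rewrite mxE; case: ifP => [/above_rank->//|]; rewrite eqxx.
rewrite -(pair_big_dep xpredT lower (fun v u => ycoord v - ycoord u)) -scaler_prod.
by apply: eq_bigr => v _; rewrite mxE ifT //; apply: connect0.
Qed.

Lemma graph_basis_isolated v x : (forall u, ~~ e v u) \/ (forall u, ~~ e x u) ->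
  graph_basis v x = (w v)%:MP *+ (v == x).
Proof.
move=> iso; rewrite mxE; have -> : above v x = (v == x).
  apply/idP/eqP => [|->]; last exact: connect0.
  case/connectP => p; case: iso => iso.
    by case: p => [_ ->//|y p /= /andP[/andP[vy _] _]]; case/negP: (iso y).
  case/lastP: p => [_ ->//|p y]; rewrite rcons_path last_rcons.
  by move=> /andP[_ /andP[ey _]] xE; case/negP: (iso (last v p)); rewrite xE supp_edge_sym.
case: eqP => // E; rewrite mulr1n big1 ?mpolyCD -?E; last first.
  by move=> u /andP[vu _]; rewrite -E in iso; case: iso => /(_ u)/negP.
by rewrite -alg_mpolyC.
Qed.

End Elimination.
End GraphicForms.

(** * Chordless cycles *)

Section Avoidance.

Variable k : closedFieldType.
Hypothesis char0 : [pchar k] =i pred0.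

Lemma natr_inj : injective (fun n : nat => n%:R : k).
Proof.
have nat0 := (pcharf0P k).1 char0.
move=> a b; wlog ab : a b / (a <= b)%N => [H|/eqP].
  by move=> E; case/orP: (leq_total a b) => [/H->//|/H->].
by rewrite eq_sym -subr_eq0 -natrB // nat0 subn_eq0 => ba; apply/eqP; rewrite eqn_leq ab.
Qed.

Lemma fresh_scalar (r : seq k) : exists t, t \notin r.
Proof.
have [/hasP[t _ tr]|] := boolP (has (fun t => t \notin r) [seq n%:R | n <- iota 0 (size r).+1]).
  by exists t.
rewrite -all_predC => /allP h.
have /uniq_leq_size : uniq [seq n%:R : k | n <- iota 0 (size r).+1].
  by rewrite (map_inj_uniq natr_inj) iota_uniq.
move/(_ r); rewrite size_map size_iota ltnn => le.
suff: false by [].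
by apply: le => t /h /=; rewrite negbK.
Qed.

Definition eval_form m (l v : 'rV[k]_m) : k := \sum_i l 0 i * v 0 i.

Lemma eval_formD m (l v v' : 'rV[k]_m) t :
  eval_form l (v + t *: v') = eval_form l v + t * eval_form l v'.
Proof.
rewrite /eval_form mulr_sumr -big_split; apply: eq_bigr => i _ /=.
by rewrite !mxE; ring.
Qed.

Lemma eval_delta m (l : 'rV[k]_m) i : eval_form l (delta_mx 0 i) = l 0 i.
Proof.
rewrite /eval_form (bigD1 i) //= big1 => [|j /negPf ji].
  by rewrite mxE !eqxx mulr1 addr0.
by rewrite mxE ji andbF mulr0.
Qed.

(** A vector space over an infinite field is not a finite union of proper subspaces; [P] plays the
    part of the space. Given [v] good for the earlier forms and [v'] good for the new one, $v+tv'$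
    is good for all but finitely many $t$. *)
Lemma avoid_hyperplanes m (P : 'rV[k]_m -> Prop) (s : seq 'rV[k]_m) :
  P 0 -> (forall v v' t, P v -> P v' -> P (v + t *: v')) ->
  (forall l, l \in s -> exists2 v, P v & eval_form l v != 0) ->
  exists2 v, P v & forall l, l \in s -> eval_form l v != 0.
Proof.
move=> P0 PD; elim: s => [|l s IH] h; first by exists 0.
have [|v Pv vs] := IH; first by move=> a as_; apply: h; rewrite inE as_ orbT.
have [v' Pv' lv'] := h l (mem_head _ _).
have [t] := fresh_scalar [seq - (eval_form a v / eval_form a v') | a <- l :: s].
move=> tr; exists (v + t *: v') => [|a als]; first exact: PD.
rewrite eval_formD; have [z|nz] := eqVneq (eval_form a v') 0.
  rewrite z mulr0 addr0; apply: vs; move: als; rewrite inE => /orP[/eqP al|//].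
  by rewrite -al z eqxx in lv'.
apply: contra tr => /eqP E; apply/mapP; exists a => //.
by apply: (mulIf nz); rewrite mulNr divfK //; apply/eqP; rewrite -addr_eq0 addrC E.
Qed.

End Avoidance.

(** * Orders of vanishing along a line *)

Section OrderAlongLine.

Variable k : closedFieldType.

Definition line_eval m (q p : 'I_m -> k) : {mpoly k[m]} -> {poly k} :=
  mmap (@polyC k) (fun i => (q i)%:P + p i *: 'X).

HB.instance Definition _ m (q p : 'I_m -> k) :=
  GRing.RMorphism.copy (line_eval q p) (line_eval q p).

Lemma line_evalC m (q p : 'I_m -> k) c : line_eval q p c%:MP = c%:P.
Proof. exact: mmapC. Qed.

Lemma line_evalZ m (q p : 'I_m -> k) c f :
  line_eval q p (c *: f) = c *: line_eval q p f.
Proof. by rewrite -mul_mpolyC rmorphM /= line_evalC mul_polyC. Qed.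

Lemma line_evalX m (q p : 'I_m -> k) i :
  line_eval q p 'X_i = (q i)%:P + p i *: 'X.
Proof. by rewrite /line_eval mmapX mmap1U. Qed.

Lemma line_eval_form m (q p l : 'rV[k]_m) :
  line_eval (q 0) (p 0) (form_poly l) =
  (eval_form l q)%:P + eval_form l p *: 'X.
Proof.
rewrite /form_poly rmorph_sum /= /eval_form rmorph_sum scaler_suml -big_split.
apply: eq_bigr => i _ /=; rewrite line_evalZ line_evalX scalerDr scalerA.
by rewrite -[_ *: (q 0 i)%:P]mul_polyC -polyCM.
Qed.

Lemma line_eval0 m (q p : 'I_m -> k) f : (line_eval q p f).[0] = f.@[q].
Proof.
apply: (mpoly_ring_ind (P := fun f => (line_eval q p f).[0] = f.@[q])) f
  => [c|i|f g hf hg|f g hf hg].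
- by rewrite line_evalC hornerC mevalC.
- by rewrite line_evalX mevalXU hornerD hornerC hornerZ hornerX mulr0 addr0.
- by rewrite rmorphD /= hornerD mevalD hf hg.
- by rewrite rmorphM /= hornerM mevalM hf hg.
Qed.

Lemma dividesX (f : {poly k}) : f.[0] = 0 -> divides 'X f.
Proof.
move=> /eqP /factor_theorem[g ->]; exists g; by rewrite polyC0 subr0.
Qed.

Lemma order_prod (I : eqType) (s : seq I) (F : I -> {poly k}) (Z : pred I)
    (d : k) n :
  d != 0 -> {in s, forall i, if Z i then exists2 c, c != 0 & F i = c *: 'X
                   else (F i).[0] != 0} ->
  divides ('X ^+ n) (d *: \prod_(i <- s) F i) -> (n <= count Z s)%N.
Proof.
move=> d0 h [g gE].
have [u u0 E] : exists2 u, u.[0] != 0 & \prod_(i <- s) F i = u * 'X ^+ count Z s.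
  elim: s h {gE} => [|i s IH] h; first by exists 1;
    rewrite ?big_nil ?mulr1 // hornerC oner_eq0.
  have [|u u0 E] := IH; first by move=> j js; apply: h; rewrite inE js orbT.
  have := h i (mem_head _ _); rewrite big_cons E /=; case: (Z i) => [[c c0 ->]|Fi].
    exists (c *: u); first by rewrite hornerZ mulf_neq0.
    by rewrite add1n exprS -!scalerAl mulrCA.
  by exists (F i * u); rewrite ?add0n ?mulrA // hornerM mulf_neq0.
rewrite E in gE; rewrite leqNgt; apply/negP => lt.
have : d *: u = g * 'X ^+ (n - count Z s).
  apply: (mulIf (expf_neq0 (count Z s) (negbT (polyX_eq0 k)))).
  by rewrite -scalerAl gE -mulrA -exprD subnK // ltnW.
move/(congr1 (fun f => f.[0])); rewrite hornerZ hornerM hornerXn expr0n subn_eq0 leqNgt lt.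
by move/eqP; rewrite mulr0 mulf_eq0 (negPf d0) (negPf u0).
Qed.

Lemma divides_det_cols (R : comNzRingType) n (N : 'M[R]_n) (x : R) (d : 'I_n -> nat) :
  (forall i j, divides (x ^+ d j) (N i j)) -> divides (x ^+ \sum_j d j) (\det N).
Proof.
move=> h; have /fin_all_exists[C CE] : forall i, exists c : {ffun 'I_n -> R},
    forall j, N i j = c j * x ^+ d j.
  move=> i; have /fin_all_exists[c cE] := h i.
  by exists (finfun c) => j; rewrite ffunE.
exists (\det (\matrix_(i, j) C i j)).
rewrite -prodrXr; have -> : N = (\matrix_(i, j) C i j) *m diag_mx (\row_j x ^+ d j).
  by apply/matrixP => i j; rewrite mul_mx_diag !mxE CE.
rewrite det_mulmx det_diag; congr (_ * _); apply: eq_bigr => j _; by rewrite mxE.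
Qed.

End OrderAlongLine.

Section ChordlessCycle.

Variable k : closedFieldType.
Hypothesis char0 : [pchar k] =i pred0.
Variables (m : nat) (A D : {fset 'rV[k]_m}) (w : 'I_m -> k).
Hypothesis arrA : is_arrangement A.
Hypothesis arrD : is_arrangement D.
Hypothesis w0 : forall i, w i != 0.
Hypothesis suppD : forall l, l \in D -> #|supp l| = 2%N.
Hypothesis sumD : forall l, l \in D -> \sum_i l 0 i * w i = 0.
Hypothesis subD : D `<=` A.
Local Notation e := (supp_edge D).
Hypothesis isoA : forall l i j, l \in A -> l \notin D -> l 0 i != 0 -> ~~ e i j.

Variable M : 'M[{mpoly k[m]}]_m.
Hypothesis saitoM : saito_basis A M.

Variables (x0 : 'I_m) (c : seq 'I_m).
Hypothesis cE : c = x0 :: behead c.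
Hypothesis cyc : ucycle e c.
Hypothesis size_c : (4 <= size c)%N.
Hypothesis chordless : forall x y, x \in c -> y \in c -> e x y ->
  y = next c x \/ x = next c y.

Let uc : uniq c. Proof. by case/andP: cyc. Qed.
Local Notation node a := (nth x0 c a).

Let next_node a : (a.+1 < size c)%N -> next c (node a) = node a.+1.
Proof.
move=> lt; rewrite next_nth mem_nth 1?ltnW // index_uniq 1?ltnW //.
by move: cE; case: (c) => // y s [->].
Qed.

Let edge_next x : x \in c -> e x (next c x).
Proof. by apply: next_cycle; case/andP: cyc. Qed.

Let next_neq x : x \in c -> x != next c x. Proof. by move=> /edge_next/andP[]. Qed.

Let cycle_formP x : x \in c ->
  exists2 l, l \in D & x != next c x /\ supp l = [set x; next c x].
Proof. by move/edge_next/edge_formP. Qed.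

Let cycle_form l := (l \in D) && [exists x, (x \in c) && (supp l == [set x; next c x])].

(** The flat of the cycle: all rescaled coordinates along it agree. *)
Let inK (v : 'rV[k]_m) := forall x, x \in c -> (w x)^-1 * v 0 x = (w x0)^-1 * v 0 x0.

Let inK0 : inK 0. Proof. by move=> x _; rewrite !mxE !mulr0. Qed.

Let inKD v v' t : inK v -> inK v' -> inK (v + t *: v').
Proof.
move=> h h' x xc; rewrite !mxE !mulrDr h //; congr (_ + _).
by rewrite mulrCA h' // mulrCA.
Qed.

(** A form with a variable off the cycle is nonzero on a unit vector of the flat. A form supported
    on the cycle lies in [D] by [isoA], and having no chords makes it one of the cycle edges. *)
Let base_point : exists2 q, inK q &
  forall l, l \in A -> ~~ cycle_form l -> eval_form l q != 0.
Proof.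
have [] := @avoid_hyperplanes k char0 m inK [seq l <- A | ~~ cycle_form l] inK0 inKD;
  last first.
  by move=> q Kq h; exists q => // l lA lc; apply: h; rewrite mem_filter lc.
move=> l; rewrite mem_filter => /andP[lc lA].
suff [i li ic] : exists2 i, l 0 i != 0 & i \notin c.
  exists (delta_mx 0 i).
    move=> x xc; rewrite !mxE !eqxx /=.
    have ne y : y \in c -> (y == i) = false by move=> yc; apply: contraNF ic => /eqP<-.
    by rewrite !ne ?mulr0 // [in X in _ \in X]cE mem_head.
  by rewrite eval_delta.
have [lD|lD] := boolP (l \in D); last first.
  have [i li] := rV_neq0 (arrA.1 l lA); exists i => //; apply/negP => ic.
  by case/negP: (isoA (next c i) lA lD li); apply: edge_next.
have /eqP/cards2P[i [j [ij sl]]] := suppD lD.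
have li : l 0 i != 0 by rewrite -in_supp sl !inE eqxx.
have lj : l 0 j != 0 by rewrite -in_supp sl !inE eqxx orbT.
have [ic|] := boolP (i \in c); last by exists i.
have [jc|] := boolP (j \in c); last by exists j.
case/negP: lc; rewrite /cycle_form lD; apply/existsP.
case: (chordless ic jc (edge_supp2 lD ij sl)) => E.
  by exists i; rewrite ic sl -E eqxx.
by exists j; rewrite jc sl -E setUC eqxx.
Qed.

Lemma chordless_cycle_not_free : False.
Proof.
have [logM [d d0 detM]] := saitoM.
have [q Kq qA] := base_point.
(* Along this direction the rescaled coordinate of the $a$-th node grows with slope $a$, so
   consecutive nodes differ by exactly $t$, and in characteristic 0 no cycle edge stays zero on the
   line. *)
pose p : 'rV[k]_m := \row_i (w i * (index i c)%:R).
pose ev := line_eval (q 0) (p 0).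
have evy x y : x \in c -> y \in c ->
    ev (ycoord w x - ycoord w y) = ((index x c)%:R - (index y c)%:R) *: 'X.
  move=> xc yc; rewrite /ev rmorphB /= !line_evalZ !line_evalX !scalerDr.
  rewrite -![_ *: _%:P]mul_polyC -!polyCM (Kq x xc) (Kq y yc) !scalerA !mxE.
  by rewrite !mulKf // scalerBl opprD addrACA subrr add0r.
(* The order of the determinant at the base point is at most [size c].        *)
have ordA n : divides ('X ^+ n) (ev (\det M)) -> (n <= size c)%N.
  rewrite detM /ev line_evalZ /form_prod rmorph_prod /=.
  move/(order_prod (Z := cycle_form) d0) => le.
  apply: (leq_trans (le _)) => {le}.
    move=> l lA; rewrite line_eval_form; case: ifPn => lc.
      have /andP[lD /existsP[x /andP[xc /eqP sl]]] := lc.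
      have ne := next_neq xc.
      have nc : next c x \in c by rewrite mem_next.
      exists ((l 0 x * w x) * ((index x c)%:R - (index (next c x) c)%:R)).
        rewrite !mulf_neq0 // -?in_supp ?sl ?inE ?eqxx // subr_eq0.
        rewrite (inj_eq (natr_inj char0)); apply: contra ne => /eqP E.
        by apply/eqP; rewrite -[LHS](nth_index x0 xc) E nth_index.
      rewrite -line_eval_form (form_supp2 w0 sumD lD ne sl) line_evalZ.
      by rewrite -/ev evy // scalerA.
    by rewrite hornerD hornerC hornerZ hornerX mulr0 addr0 qA.
  pose F x := nth 0 D (find (fun l => supp l == [set x; next c x]) D).
  rewrite -size_filter; apply: (@leq_trans (size (map F c))); last by rewrite size_map.
  apply: uniq_leq_size; first by rewrite filter_uniq ?fset_uniq.
  move=> l; rewrite mem_filter => /andP[/andP[lD /existsP[x /andP[xc /eqP sl]]] _].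
  have hasl : has (fun l => supp l == [set x; next c x]) D by apply/hasP; exists l;
    rewrite ?sl.
  apply/mapP; exists x => //; apply: (supp_eq arrD w0 suppD sumD) => //.
    by rewrite mem_nth // -has_find.
  by rewrite sl; apply/esym/eqP/(nth_find 0 hasl).
(* [M i x - M i y] is, up to scaling, a multiple [g x] of the form of the edge *)
(* [xy]; as these forms sum to zero around the cycle, [g] is constant at [q].  *)
pose T i x := ev ((w x)^-1 *: M i x).
have rowP i : exists g : 'I_m -> {mpoly k[m]}, forall x, x \in c ->
    (w x)^-1 *: M i x - (w (next c x))^-1 *: M i (next c x)
      = g x * (ycoord w x - ycoord w (next c x)).
  suff /fin_all_exists[g gE] : forall x, exists g, x \in c ->
    (w x)^-1 *: M i x - (w (next c x))^-1 *: M i (next c x)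
      = g * (ycoord w x - ycoord w (next c x)) by exists g.
  move=> x; have [xc|_] := boolP (x \in c); last by exists 0.
  have [l lD [ne sl]] := cycle_formP xc.
  have [g] := logM i l (fsubsetP subD _ lD).
  rewrite (pairing_supp2 w0 sumD _ lD ne sl) (form_supp2 w0 sumD lD ne sl) -scalerAr => E.
  exists g => _; apply: scalerI E; rewrite mulf_neq0 // -in_supp sl !inE eqxx //.
have yq x y : x \in c -> y \in c -> (ycoord w x - ycoord w y).@[q 0] = 0.
  by move=> xc yc; rewrite mevalB !mevalZ !mevalXU (Kq x xc) (Kq y yc) subrr.
have dy x u : (ycoord w x)^`M(u) = ((w x)^-1 *+ (x == u))%:MP.
  by rewrite mderivZ mderivXU -mul_mpolyC -mpolyC_nat -mpolyCM mulr_natr.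
have gq i g (gE : forall x, x \in c ->
    (w x)^-1 *: M i x - (w (next c x))^-1 *: M i (next c x)
      = g x * (ycoord w x - ycoord w (next c x))) x :
    x \in c -> (g (next c x)).@[q 0] = (g x).@[q 0].
  move=> xc; pose u := next c x; have ucin : u \in c by rewrite mem_next.
  (* The differences telescope around the cycle. In the derivative at [q] the edge forms vanish, and
     only the two edges at [u] contain its variable, leaving $g_u(q)=g_x(q)$. *)
  have /(congr1 (fun f => f^`M(u).@[q 0])) :
      \sum_(y in c) g y * (ycoord w y - ycoord w (next c y)) = 0.
    under eq_bigr => y yc do rewrite -gE //.
    rewrite sumrB [X in X - _](reindex_inj (can_inj (prev_next uc))) /=.
    by under [X in X - _]eq_bigl => y do rewrite mem_next; rewrite subrr.
  rewrite mderiv0 meval0 (raddf_sum (mderiv u)) rmorph_sum.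
  under eq_bigr => y yc do
    rewrite /= mderivM mevalD !mevalM yq ?mem_next // mulr0 add0r mderivB !dy -mpolyCB mevalC.
  rewrite (bigD1 u) //= (bigD1 x) /=; last first.
    by rewrite xc next_neq.
  rewrite big1 => [|y /andP[/andP[yc yu] yx]]; last first.
    rewrite (negPf yu) (inj_eq (can_inj (prev_next uc))) (negPf yx) subr0 mulr0 //.
  have ne := next_neq xc; have ne' := next_neq ucin.
  have E1 : (u == u) = true by exact: eqxx.
  have E2 : (next c u == u) = false by rewrite eq_sym; apply: negbTE.
  have E3 : (x == u) = false by apply: negbTE.
  rewrite E1 E2 E3 !mulr0n !mulr1n subr0 sub0r addr0 mulrN -mulrBl => /eqP;
    rewrite mulf_eq0 invr_eq0 (negPf (w0 _)) orbF.
  by rewrite subr_eq0 => /eqP.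
have node_in a : (a < size c)%N -> node a \in c by apply: mem_nth.
have idx a : (a < size c)%N -> index (node a) c = a by move=> lt; rewrite index_uniq.
have Tstep i : exists G : nat -> {poly k}, forall a, (a.+1 < size c)%N ->
    T i (node a.+1) - T i (node a) = G a * 'X /\ (G a).[0] = (G 0%N).[0].
  have [g gE] := rowP i; have gN := gq i g gE; exists (fun a => ev (g (node a))).
  move=> a lt; have lt' := ltnW lt; split.
    have /(congr1 ev) := gE _ (node_in a lt').
    rewrite next_node // /ev rmorphM rmorphB /= -/ev -/(T i _) -/(T i _) evy ?node_in // !idx //.
    rewrite -natr1 opprD addrA subrr sub0r scaleN1r mulrN => E.
    by rewrite -[LHS]opprB E opprK.
  elim: a lt lt' => // a IH lt lt'; rewrite -IH 1?ltnW //.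
  by rewrite !line_eval0 -next_node // gN // node_in // ltnW.
have T1 i : divides 'X (T i (node 1) - T i (node 0)).
  have [G GE] := Tstep i; have [|-> _] := GE 0%N; first by rewrite (leq_trans _ size_c).
  exact/dividesMl/divides_refl.
(* Consecutive differences of [T] are $t$ times polynomials with the same value at 0, so [T] is
   affine in the node number modulo $t^2$. *)
have T2 i a : (a < size c)%N -> divides ('X ^+ 2)
    (T i (node a) - T i (node 0) - a%:R *: (T i (node 1) - T i (node 0))).
  have [G GE] := Tstep i; elim: a => [_|a IH lt].
    by rewrite scale0r subrr subr0; apply: divides0.
  have [E1 E2] := GE a lt; have [|E3 _] := GE 0%N; first by rewrite (leq_trans _ size_c).
  have -> : T i (node a.+1) - T i (node 0) - a.+1%:R *: (T i (node 1) - T i (node 0)) =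
     (T i (node a) - T i (node 0) - a%:R *: (T i (node 1) - T i (node 0)))
     + (G a - G 0%N) * 'X.
    rewrite mulrBl -E1 -E3 -natr1 scalerDl scale1r; ring.
  apply: dividesD; first exact/IH/ltnW.
  have [|h ->] := @dividesX _ (G a - G 0%N); first by rewrite hornerD hornerN E2 subrr.
  by exists h; rewrite expr2 mulrA.
(* [coef] is built so that column [j] of the product becomes [T 1 - T 0] or    *)
(* [T a - T 0 - a (T 1 - T 0)] for the [a]-th node [j] of the cycle.           *)
pose dl x (b : 'I_m) : k := (w x)^-1 *+ (b == x).
pose coef (b j : 'I_m) : k :=
  if (index j c == 0)%N || (j \notin c) then (b == j)%:R
  else if index j c == 1%N then dl (node 1) b - dl (node 0) b
  else dl j b - dl (node 0) b - (index j c)%:R * (dl (node 1) b - dl (node 0) b).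
pose Q : 'M[{poly k}]_m := \matrix_(b, j) (coef b j)%:P.
pose dg (j : 'I_m) : nat := if j \in c then minn (index j c) 2 else 0%N.
have lt0 : (0 < size c)%N by rewrite (leq_trans _ size_c).
have lt1 : (1 < size c)%N by rewrite (leq_trans _ size_c).
have detQ : exists2 z, z != 0 & \det Q = z%:P.
  (* Vertices off the cycle all have index [size c]; this is harmless because their columns are unit
     vectors. *)
  rewrite (det_triangular_rank (r := fun i => index i c)); last first.
    move=> b j bj; rewrite mxE polyC_eq0 /coef; case: ifPn => [_|].
      by rewrite (negPf bj) eqxx.
    rewrite negb_or negbK -lt0n => /andP[j0 jc].
    have dl0 : (0 < index j c)%N -> b != node 0 -> dl (node 0) b = 0.
      by move=> _ /negPf h; rewrite /dl h.
    have [->|b0] := eqVneq b (node 0); first by rewrite idx.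
    rewrite dl0 // !subr0; have [bE|b1] := eqVneq b (node 1).
      rewrite bE idx //; case: ifPn => [/eqP j1|j1 _]; last by rewrite ltn_neqAle eq_sym j1.
      by move: bj; rewrite bE -(nth_index x0 jc) j1 eqxx.
    have -> : dl (node 1) b = 0 by rewrite /dl (negPf b1).
    have -> : dl j b = 0 by rewrite /dl (negPf bj).
    by rewrite mulr0 subr0; case: ifP; rewrite eqxx.
  exists (\prod_j coef j j); last first.
    by rewrite rmorph_prod; apply: eq_bigr => j _; rewrite mxE.
  apply/prodf_neq0 => j _; rewrite /coef; case: ifPn => [_|].
    by rewrite eqxx oner_eq0.
  rewrite negb_or negbK => /andP[j0 jc].
  have nj a : (a < size c)%N -> index j c != a -> (j == node a) = false.
    by move=> lt; apply: contraNF => /eqP->; rewrite idx.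
  rewrite /dl !(nj 0%N) // mulr0n !subr0; case: ifPn => [/eqP j1|j1].
    by rewrite -j1 nth_index // eqxx invr_eq0.
  by rewrite !(nj 1%N) // mulr0n mulr0 subr0 eqxx invr_eq0.
have [z z0 detQE] := detQ.
have big_dl i x : \sum_b map_mx ev M i b * (dl x b)%:P = T i x.
  rewrite (bigD1 x) //= big1 => [|b /negPf bx]; last by rewrite /dl bx polyC0 mulr0.
  by rewrite addr0 /dl eqxx mulr1n mxE /T /ev line_evalZ mulrC mul_polyC.
have cols i j : divides ('X ^+ dg j) ((map_mx ev M *m Q) i j).
  rewrite mxE /dg; case: ifPn => [jc|_];
    last by exists (\sum_b map_mx ev M i b * Q b j); rewrite expr0 mulr1.
  have [j0|j0] := eqVneq (index j c) 0%N.
    by exists (\sum_b map_mx ev M i b * Q b j); rewrite j0 min0n expr0 mulr1.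
  have [j1|j1] := eqVneq (index j c) 1%N.
    have -> : \sum_b map_mx ev M i b * Q b j = T i (node 1) - T i (node 0).
      rewrite -!big_dl -sumrB; apply: eq_bigr => b _.
      by rewrite [Q _ _]mxE /coef j1 /= jc /= polyCB mulrBr.
    by rewrite j1.
  have -> : minn (index j c) 2 = 2%N.
    by apply/minn_idPr; case: (index j c) j0 j1 => [|[|]].
  have -> : \sum_b map_mx ev M i b * Q b j =
      T i (node (index j c)) - T i (node 0) - (index j c)%:R *: (T i (node 1) - T i (node 0)).
    rewrite nth_index // -!big_dl -!sumrB scaler_sumr -sumrB; apply: eq_bigr => b _.
    rewrite [Q _ _]mxE /coef (negPf j0) (negPf j1) jc /=.
    by rewrite !polyCB polyCM polyCB -mul_polyC; ring.
  by apply: T2; rewrite index_mem.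
have := divides_det_cols cols;
  rewrite det_mulmx detQE -/(map_mx ev M) det_map_mx => -[h hE].
have {h hE} : divides ('X ^+ (\sum_j dg j)) (ev (\det M)).
  exists (z^-1 *: h); rewrite -scalerAl -hE mulrC mul_polyC scalerA mulVf //.
  by rewrite scale1r.
move/ordA; apply/negP; rewrite -ltnNge.
have -> : (\sum_j dg j = \sum_(j <- c) dg j)%N.
  rewrite [RHS]big_uniq //= [RHS]big_mkcond; apply: eq_bigr => j _.
  by rewrite /dg; case: ifP.
rewrite (big_nth x0) big_nat (eq_bigr (fun a => minn a 2)); last first.
  by move=> a /andP[_ lt]; rewrite /dg node_in // idx.
rewrite -big_nat; case: (size c) size_c => [|[|[|[|n]]]] // _.
(* For a cycle of length $n+4$ the first four exponents are 0, 1, 2, 2; bounding the others below by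
   1 already gives $n+5$. *)
rewrite big_nat_recl // big_nat_recl // big_nat_recl // big_nat_recl //=.
have : (\sum_(0 <= i < n) 1 <= \sum_(0 <= i < n) minn i.+4 2)%N by apply: leq_sum.
by rewrite sum_nat_const_nat subn0 muln1 -(leq_add2l 5).
Qed.

End ChordlessCycle.

(** * Hypertetrahedral localizations *)

Section Splitting.

Variable k : closedFieldType.
Hypothesis char0 : [pchar k] =i pred0.
Variables (m : nat) (A B : {fset 'rV[k]_m}) (w : 'I_m -> k) (G : sgraph 'I_m).
Let D := A `\` B.
Hypothesis arrA : is_arrangement A.
Hypothesis subB : B `<=` A.
Hypothesis w0 : forall i, w i != 0.
Hypothesis wB : forall i, i \in arr_supp B -> w i = 1.
Hypothesis suppD : forall l, l \in D -> #|supp l| = 2%N.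
Hypothesis sumD : forall l, l \in D -> \sum_i l 0 i * w i = 0.
Hypothesis disjD : forall l i, l \in D -> i \in arr_supp B -> l 0 i = 0.
Hypothesis edgeG : edge G = supp_edge D.

Lemma sub_arrangement (A1 A2 : {fset 'rV[k]_m}) :
  A1 `<=` A2 -> is_arrangement A2 -> is_arrangement A1.
Proof.
move=> /fsubsetP s [nz inj]; split=> [l /s|l l' /s lA /s l'A]; first exact: nz.
exact: inj.
Qed.

Lemma supported_arr_supp l : l \in B -> supported (arr_supp B) l.
Proof.
move=> lB i; rewrite /arr_supp (big_rem l lB) /= in_setU negb_or => /andP[].
by rewrite inE negbK => /eqP.
Qed.

Let arrB := sub_arrangement subB arrA.
Let arrD : is_arrangement D := sub_arrangement (fsubsetDl A B) arrA.
Let S := arr_supp B.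

Let isolated i j : i \in S -> ~~ supp_edge D i j.
Proof.
move=> iS; apply/edge_formP => -[l lD [_ sl]].
have : i \in supp l by rewrite sl !inE eqxx.
by rewrite inE disjD ?eqxx.
Qed.

(** The forms of [D] have no variable in the support of [B], so a point vanishing on that support
    can avoid all of them; [saito_freeze] then applies. *)
Lemma free_restriction : free_arr A -> free_arr (arr_pi B).
Proof.
move=> /(free_saito (arrangement_coprime arrA))[M saitoM].
have [|v v' t Pv Pv'|l lD|q qS qD] := @avoid_hyperplanes k char0 m
  (fun v => forall i, i \in S -> v 0 i = 0) D.
- by move=> i _; rewrite mxE.
- by move=> i iS; rewrite !mxE Pv // Pv' // mulr0 addr0.
- have [i li] := rV_neq0 (arrD.1 l lD); exists (delta_mx 0 i).
    move=> j jS; rewrite mxE eqxx /=; case: eqP => // ji; case/eqP: li.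
    by apply: disjD; rewrite // -ji.
  by rewrite eval_delta.
have [|M' saitoM'] := saito_freeze arrB supported_arr_supp subB saitoM qS.
  by move=> l lA lB; apply: qD; rewrite !inE lB.
exact: saito_free (restrs_coprime arrB supported_arr_supp) saitoM'.
Qed.

Lemma free_chordal : free_arr A -> chordal G.
Proof.
move=> /(free_saito (arrangement_coprime arrA))[M saitoM] c cyc sz.
have [/existsP[x /existsP[y /and5P[xc yc exy ny nx]]]|none] := boolP [exists x, [exists y,
    [&& x \in c, y \in c, edge G x y, y != next c x & x != next c y]]].
  by exists x, y.
have isoA l i j : l \in A -> l \notin D -> l 0 i != 0 -> ~~ supp_edge D i j.
  move=> lA; rewrite inE lA andbT negbK => lB li; apply: isolated.
  by apply: contraNT li => iS; rewrite (supported_arr_supp lB).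
have [x0 cE] : exists x0, c = x0 :: behead c by case: c sz {cyc none} => // x c' _;
  exists x.
rewrite edgeG in cyc none.
exfalso; apply: (chordless_cycle_not_free char0 arrA arrD w0 suppD sumD
  (fsubsetDl A B) isoA saitoM cE cyc sz) => x y xc yc exy.
have := none; rewrite negb_exists => /forallP/(_ x).
rewrite negb_exists => /forallP/(_ y); rewrite xc yc exy /= negb_and !negbK.
by case/orP => /eqP; [left | right].
Qed.

(** [N1] is the identity outside the support of [B], and [N2] is the identity on it since its
    indices are isolated vertices of weight 1. So each row of the product is a row of one of them,
    and the determinants multiply. *)
Lemma chordal_free : free_arr (arr_pi B) -> chordal G -> free_arr A.
Proof.
move=> freeB chG.
have [M saitoM] := free_saito (restrs_coprime arrB supported_arr_supp) freeB.
have [N1 [[logN1 [c1 c10 detN1]] N1out N1in]] := saito_extend supported_arr_supp saitoM.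
have [r [r_inj r_elim]] := chordal_elimination chG; rewrite edgeG in r_elim.
pose N2 := graph_basis D w r.
have N2iso v x : v \in S \/ x \in S -> N2 v x = (v == x)%:R.
  move=> h; rewrite /N2 graph_basis_isolated //; last first.
    by case: h => h; [left | right] => u; apply: isolated.
  case: eqP => // E; rewrite mulr1n wB //.
  by case: h => //; rewrite E.
have [c2 c20 detN2] := det_graph_basis arrD w0 suppD sumD r_inj.
have logN2 v : log_coeffs D (N2 v) by apply: graph_basis_log.
apply: (@saito_free _ _ A (N1 *m N2) (arrangement_coprime arrA)); split; last first.
  exists (c1 * c2); first by rewrite mulf_neq0.
  rewrite det_mulmx detN1 detN2 -scalerAl -scalerAr scalerA; congr (_ *: _).
  rewrite [RHS]/form_prod (@big_fsetID _ _ _ _ (mem B) A) /=; congr (_ * _).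
    apply: eq_fbigl => l; rewrite !inE /=.
    by apply/esym/andb_idl; apply/fsubsetP.
  by apply: eq_fbigl => l; rewrite !inE andbC.
move=> i l lA; have [iS|iS] := boolP (i \in S).
  have rowE j : (N1 *m N2) i j = N1 i j.
    rewrite mxE (bigD1 j) //= big1 => [|a aj].
      rewrite addr0; have [jS|jS] := boolP (j \in S); last by rewrite N1in // mul0r.
      by rewrite N2iso ?eqxx ?mulr1 //; left.
    have [aS|aS] := boolP (a \in S); last by rewrite N1in // mul0r.
    by rewrite N2iso ?(negPf aj) ?mulr0 //; left.
  have -> : pairing l ((N1 *m N2) i) = pairing l (N1 i).
    by apply: eq_bigr => j _; rewrite rowE.
  have [lB|lB] := boolP (l \in B); first exact: logN1.
  rewrite (_ : pairing _ _ = 0); first exact: divides0.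
  rewrite /pairing big1 // => j _; have [jS|jS] := boolP (j \in S).
    by rewrite disjD ?scale0r // !inE lB.
  by rewrite N1in // scaler0.
have rowE j : (N1 *m N2) i j = N2 i j.
  rewrite mxE (bigD1 i) //= big1 => [|a ai];
    last by rewrite N1out // eq_sym (negPf ai) mul0r.
  by rewrite N1out // eqxx mul1r addr0.
have -> : pairing l ((N1 *m N2) i) = pairing l (N2 i).
  by apply: eq_bigr => j _; rewrite rowE.
have [lB|lB] := boolP (l \in B); last by apply: logN2; rewrite !inE lB.
rewrite (_ : pairing _ _ = 0); first exact: divides0.
rewrite /pairing big1 // => j _; have [jS|jS] := boolP (j \in S).
  rewrite N2iso; last by right.
  by case: eqP => [E|_]; rewrite ?scaler0 //; case/negP: iS; rewrite E.
by rewrite (supported_arr_supp lB) // scale0r.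
Qed.

End Splitting.

(** * The linear isomorphism onto the product *)

Section LocalizationIso.

Variable k : closedFieldType.

Lemma sum_enum_delta m (T : {set 'I_m}) (x : 'I_m) (F : 'I_m -> k) :
  \sum_(a < #|T|) (x == enum_val a)%:R * F (enum_val a) = (x \in T)%:R * F x.
Proof.
have [xT|xT] := boolP (x \in T); last first.
  rewrite mul0r big1 // => a _; case: eqP => [E|]; rewrite ?mul0r //.
  by case/negP: xT; rewrite E enum_valP.
rewrite (bigD1 (enum_rank_in xT x)) //= enum_rankK_in // eqxx big1 ?addr0 // => a ax.
case: eqP => [E|]; rewrite ?mul0r //; case/eqP: ax.
by apply: enum_val_inj; rewrite enum_rankK_in.
Qed.

Lemma limg_hyp m1 m2 (P : 'M[k]_(m1, m2)) (Q : 'M[k]_(m2, m1))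
    (l : 'rV[k]_m1) (l' : 'rV[k]_m2) c :
  P *m Q = 1%:M -> Q *m P = 1%:M -> c != 0 -> P *m l'^T = c *: l^T ->
  (linfun (mulmxr P) @: hyp l)%VS = hyp l'.
Proof.
move=> PQ QP c0 E; apply/vspaceP => y; rewrite mem_hyp.
have -> : (y *m l'^T == 0) = (y *m Q *m l^T == 0).
  rewrite -{1}[y]mulmx1 -QP mulmxA -[y *m Q *m P *m _]mulmxA E -scalemxAr.
  by rewrite scaler_eq0 (negPf c0).
apply/memv_imgP/idP => [[x]|yQ].
  by rewrite mem_hyp lfunE /= => xl ->; rewrite -[x *m P *m Q]mulmxA PQ mulmx1.
exists (y *m Q); first by rewrite mem_hyp.
by rewrite lfunE /= -mulmxA QP mulmx1.
Qed.

Variables (m : nat) (A B : {fset 'rV[k]_m}) (w : 'I_m -> k) (G : sgraph 'I_m).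
Let D := A `\` B.
Hypothesis subB : B `<=` A.
Hypothesis w0 : forall i, w i != 0.
Hypothesis suppD : forall l, l \in D -> #|supp l| = 2%N.
Hypothesis sumD : forall l, l \in D -> \sum_i l 0 i * w i = 0.
Hypothesis disjD : forall l i, l \in D -> i \in arr_supp B -> l 0 i = 0.
Hypothesis vertsG : verts G = arr_supp D.
Hypothesis edgeG : edge G = supp_edge D.

Local Notation SA := (arr_supp A).
Local Notation SB := (arr_supp B).
Local Notation V := (verts G).

Lemma arr_suppP (C : {fset 'rV[k]_m}) i :
  reflect (exists2 l, l \in C & l 0 i != 0) (i \in arr_supp C).
Proof.
apply: (iffP idP) => [|[l lC li]].
  rewrite /arr_supp big_seq; elim/big_rec: _ => [|l U lC IH]; first by rewrite inE.
  by rewrite in_setU => /orP[|//]; rewrite inE => li; exists l.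
by rewrite /arr_supp (big_rem l lC) /= !inE li.
Qed.

Let disj i : i \in V -> i \in SB -> False.
Proof.
rewrite vertsG => /arr_suppP[l lD li] iB; case/eqP: li; exact: disjD.
Qed.

Let union i : (i \in SA) = (i \in SB) || (i \in V).
Proof.
rewrite vertsG; apply/arr_suppP/orP => [[l lA li]|[]/arr_suppP[l lB li]].
- have [lB|lB] := boolP (l \in B); [left|right]; apply/arr_suppP; exists l => //.
  by rewrite !inE lB.
- by exists l => //; apply: (fsubsetP subB).
- by exists l => //; move: lB; rewrite inE => /andP[].
Qed.

(** On row vectors this keeps the coordinates in the support of [B] and divides those at graph
    vertices by [w]; [Q] is the inverse. *)
Let P : 'M[k]_(#|SA|, #|SB| + #|V|) := row_mx
  (\matrix_(a, b) (enum_val a == enum_val b)%:R)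
  (\matrix_(a, b) ((enum_val a == enum_val b)%:R * (w (enum_val b))^-1)).

Let Q : 'M[k]_(#|SB| + #|V|, #|SA|) := col_mx
  (\matrix_(b, a) (enum_val b == enum_val a)%:R)
  (\matrix_(b, a) ((enum_val b == enum_val a)%:R * w (enum_val b))).

Let PQ : P *m Q = 1%:M.
Proof.
rewrite mul_row_col; apply/matrixP => a a'; rewrite !mxE.
under eq_bigr => b _ do rewrite !mxE.
under [X in _ + X]eq_bigr => b _ do rewrite !mxE -mulrA [_ * w _]mulrC mulKf //.
rewrite (sum_enum_delta _ _ (fun i => (i == enum_val a')%:R)).
rewrite (sum_enum_delta _ _ (fun i => (i == enum_val a')%:R)) (inj_eq enum_val_inj).
have := enum_valP a; rewrite union => /orP[h|h]; rewrite h.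
  case: (boolP (enum_val a \in V)) => [/disj/(_ h)//|_].
  by rewrite mul1r mul0r addr0.
case: (boolP (enum_val a \in SB)) => [/(disj h)//|_].
by rewrite mul1r mul0r add0r.
Qed.

Let QP : Q *m P = 1%:M.
Proof.
rewrite mul_col_row scalar_mx_block; congr block_mx; apply/matrixP => b b'; rewrite !mxE.
- under eq_bigr => a _ do rewrite !mxE.
  rewrite (sum_enum_delta _ _ (fun i => (i == enum_val b')%:R)) (inj_eq enum_val_inj).
  by rewrite union enum_valP mul1r.
- rewrite big1 // => a _; rewrite !mxE.
  case: eqP => [E1|_]; last by rewrite mul0r.
  case: eqP => [E2|_]; last by rewrite mul0r mulr0.
  by case: (disj (i := enum_val b')); rewrite ?enum_valP // -E2 -E1 enum_valP.
- rewrite big1 // => a _; rewrite !mxE.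
  case: eqP => [E1|_]; last by rewrite !mul0r.
  case: eqP => [E2|_]; last by rewrite mulr0.
  by case: (disj (i := enum_val b)); rewrite ?enum_valP // E1 E2 enum_valP.
- under eq_bigr => a _ do rewrite !mxE -mulrA.
  rewrite (sum_enum_delta _ _ (fun i => w (enum_val b) *
    ((i == enum_val b')%:R * (w (enum_val b'))^-1))) (inj_eq enum_val_inj).
  rewrite union enum_valP orbT mul1r.
  by case: eqP => [->|_]; rewrite ?mul1r ?mulfV // mul0r mulr0.
Qed.

Let g : 'Hom('rV[k]_#|SA|, 'rV[k]_(#|SB| + #|V|)) := linfun (mulmxr P).

Let img_B l : l \in B ->
  (g @: hyp (restr SA l))%VS = hyp (row_mx (restr SB l) (0 : 'rV_#|V|)).
Proof.
move=> lB; apply: (limg_hyp PQ QP (oner_neq0 k)).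
rewrite tr_row_mx mul_row_col trmx0 mulmx0 addr0 scale1r.
apply/matrixP => a z; rewrite !mxE !ord1.
under eq_bigr => b _ do rewrite !mxE.
rewrite (sum_enum_delta _ _ (fun i => l 0 i)).
have [_|aS] := boolP (enum_val a \in SB); first by rewrite mul1r.
by rewrite (supported_arr_supp lB) // mulr0.
Qed.

Let img_D l (e1 e2 : 'I_#|V|) : l \in D -> e1 != e2 ->
  supp l = [set enum_val e1; enum_val e2] ->
  (g @: hyp (restr SA l))%VS =
  hyp (row_mx (0 : 'rV_#|SB|) (delta_mx 0 e1 - delta_mx 0 e2)).
Proof.
move=> lD ne sl; set i := enum_val e1 in sl; set j := enum_val e2 in sl.
have ij : i != j by rewrite (inj_eq enum_val_inj).
have li : l 0 i != 0 by rewrite -in_supp sl !inE eqxx.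
have c0 : (l 0 i * w i)^-1 != 0 by rewrite invr_eq0 mulf_neq0.
apply: (limg_hyp PQ QP c0).
rewrite tr_row_mx mul_row_col trmx0 mulmx0 add0r.
apply/matrixP => a z; rewrite !mxE !ord1; set x := enum_val a.
under eq_bigr => b _ do rewrite !mxE eqxx /= mulrBr.
rewrite sumrB (bigD1 e1) //= big1 => [|b /negPf->]; last by rewrite mulr0.
rewrite [X in _ - X](bigD1 e2) //= big1 => [|b /negPf->]; last by rewrite mulr0.
rewrite !eqxx !mulr1 !addr0 -/i -/j -/x.
have lj := supp2_weight sumD lD ij sl.
have [xi|xi] := eqVneq x i.
  by rewrite xi (negPf ij) mul1r mul0r subr0 invfM mulrAC mulVf // mul1r.
have [xj|xj] := eqVneq x j.
  rewrite xj mul0r sub0r mul1r; apply: (mulIf (w0 j)).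
  by rewrite mulNr mulVf // -mulrA lj mulrN mulVf // mulf_neq0.
have : x \notin supp l by rewrite sl !inE negb_or xi.
by rewrite in_supp negbK => /eqP->; rewrite !mul0r mulr0 subrr.
Qed.

Lemma localization_iso :
  arr_iso (arr_pi A) (arr_prod (arr_pi B) (graphic k G)).
Proof.
exists g.
  exists (linfun (mulmxr Q)) => x; rewrite !lfunE /= -mulmxA.
    by rewrite PQ mulmx1.
  by rewrite QP mulmx1.
have mem_pi l : l \in A -> (g @: hyp (restr SA l))%VS \in
    [fset (g @: H)%VS | H in hyps (arr_pi A)].
  move=> lA; apply/imfsetP; exists (hyp (restr SA l)) => //.
  apply/imfsetP; exists (restr SA l) => //.
  by apply/imfsetP; exists l.
apply/fsetP => H; apply/idP/idP.
  case/imfsetP => l' /= l'in ->; move: l'in;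
    rewrite in_fsetU => /orP[]/imfsetP[/= l'' l''in ->].
    case/imfsetP: l''in => /= l lB ->; rewrite -(img_B lB).
    exact/mem_pi/(fsubsetP subB).
  case/imfsetP: l''in => /= -[e1 e2] /=;
    rewrite inE /= edgeG => /andP[lt /edge_formP[l lD [ne sl]]] ->.
  have e12 : e1 != e2 by rewrite neq_ltn lt.
  rewrite -(img_D lD e12 sl); apply: mem_pi.
  by move: lD; rewrite inE => /andP[].
case/imfsetP => _ /imfsetP[/= _ /imfsetP[/= l lA ->] ->] ->.
have [lB|lB] := boolP (l \in B).
  rewrite -/(restr SA l) (img_B lB); apply/imfsetP; exists (row_mx (restr SB l) 0) => //=.
  rewrite in_fsetU; apply/orP; left; apply/imfsetP; exists (restr SB l) => //.
  by apply/imfsetP; exists l.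
have lD : l \in D by rewrite !inE lB.
have /eqP/cards2P[i [j [ij sl]]] := suppD lD.
have inV x : x \in supp l -> x \in V.
  by rewrite in_supp => lx; rewrite vertsG; apply/arr_suppP; exists l.
have [e1 e1E] : exists e1 : 'I_#|V|, enum_val e1 = i.
  have iV : i \in V by apply: inV; rewrite sl !inE eqxx.
  by exists (enum_rank_in iV i); rewrite enum_rankK_in.
have [e2 e2E] : exists e2 : 'I_#|V|, enum_val e2 = j.
  have jV : j \in V by apply: inV; rewrite sl !inE eqxx orbT.
  by exists (enum_rank_in jV j); rewrite enum_rankK_in.
(* [graphic] lists each edge with its smaller end first. *)
wlog lt : i j e1 e2 e1E e2E ij sl / (e1 < e2)%N.
  move=> W; have : e1 != e2 by apply: contra_neq ij => E; rewrite -e1E -e2E E.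
  rewrite neq_ltn => /orP[lt|lt]; first exact: (W i j e1 e2).
  by apply: (W j i e2 e1); rewrite // 1?eq_sym // setUC.
have e12 : e1 != e2 by rewrite neq_ltn lt.
rewrite -/(restr SA l) (img_D lD e12) ?e1E ?e2E //.
apply/imfsetP; exists (row_mx 0 (delta_mx 0 e1 - delta_mx 0 e2)) => //=.
rewrite in_fsetU; apply/orP; right; apply/imfsetP.
exists (delta_mx 0 e1 - delta_mx 0 e2) => //.
apply/imfsetP; exists (e1, e2) => //=; rewrite inE /= lt edgeG e1E e2E.
exact: edge_supp2 lD ij sl.
Qed.

End LocalizationIso.

(** * Hyperplanes through [X] compared with those through [W X] *)

Section LocalStructure.

Variable k : closedFieldType.
Hypothesis char0 : [pchar k] =i pred0.
Variables (m : nat) (A : {fset 'rV[k]_m}) (X : {vspace 'rV[k]_m}).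
Hypothesis hypA : hypertetrahedral A.

Local Notation AX := (localization A X).
Local Notation AW := (localization A (W X)).

Lemma mem_localization (C : {fset 'rV[k]_m}) U l :
  (l \in localization C U) = (l \in C) && (U <= hyp l)%VS.
Proof. by rewrite !inE. Qed.

Lemma mem_coordH (i : 'I_m) v : (v \in coordH k i) = (v 0 i == 0).
Proof.
rewrite mem_hypE (bigD1 i) //= big1 => [|j /negPf ji].
  by rewrite mxE !eqxx mul1r addr0.
by rewrite mxE ji andbF mul0r.
Qed.

Lemma sub_W : (X <= W X)%VS.
Proof. exact/subv_bigcapP. Qed.

Lemma localization_W_sub : AW `<=` AX.
Proof.
apply/fsubsetP => l; rewrite !mem_localization => /andP[-> Wl] /=.
exact: subv_trans sub_W Wl.
Qed.

(** If [X] is not inside the [i]-th coordinate hyperplane, the [i]-th unit vector lies in [W X], so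
    [l] vanishes on it. *)
Lemma supp_localization_W l i : l \in AW -> l 0 i != 0 -> (X <= coordH k i)%VS.
Proof.
rewrite mem_localization => /andP[_ /subvP Wl]; apply: contraNT => Xi.
have := Wl (delta_mx 0 i); rewrite mem_hypE -/(eval_form _ _) eval_delta; apply.
rewrite memvE; apply/subv_bigcapP => j Xj; rewrite -memvE mem_coordH mxE eqxx /=.
case: (j =P i) => [E|_]; last exact: eqxx.
by case/negP: Xi; rewrite -E.
Qed.

Lemma supp_pair l : l \in AX -> l \notin AW ->
  exists i j, i != j /\ supp l = [set i; j].
Proof.
rewrite !mem_localization => /andP[lA Xl]; rewrite lA /= => nW.
have [[nz _] /(_ l lA)[i [j [lt /subvP Ll]]]] := hypA.
have ij : i != j by rewrite neq_ltn lt.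
have out a : a != i -> a != j -> l 0 a = 0.
  move=> ai aj; apply/eqP; rewrite -eval_delta -mem_hypE; apply: Ll.
  rewrite memv_cap !mem_coordH !mxE !eqxx /= [i == a]eq_sym [j == a]eq_sym.
  by rewrite (negPf ai) (negPf aj) eqxx.
(* A form in a single variable defines a coordinate hyperplane; containing [X], it would contain
   [W X] too. *)
have two a b : l 0 b = 0 -> (forall c, c != a -> c != b -> l 0 c = 0) -> l 0 a = 0.
  move=> lb h; apply: contraNeq nW => la.
  have lE : l = l 0 a *: delta_mx 0 a.
    apply/rowP => c; rewrite !mxE eqxx /=; have [->|ca] := eqVneq c a.
      by rewrite mulr1.
    by rewrite mulr0; have [->|cb] := eqVneq c b; rewrite ?lb ?h.
  have hE : hyp l = coordH k a by rewrite lE hypZ.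
  by rewrite hE; apply: bigcapv_inf (subvv _); rewrite -hE.
have li : l 0 i != 0.
  apply/eqP => li; case/eqP: (nz l lA); apply/rowP => a; rewrite mxE.
  have lj : l 0 j = 0 by apply: (two j i) => // c cj ci; apply: out.
  have [->//|ai] := eqVneq a i; have [->//|aj] := eqVneq a j.
  exact: out.
have lj : l 0 j != 0.
  by apply: contra_neq li => lj; apply: (two i j) => // c ci cj; apply: out.
exists i, j; split=> //; apply/setP => a; rewrite !inE.
have [->|ai] := eqVneq a i; first by rewrite li.
have [->|aj] := eqVneq a j; first by rewrite lj.
by rewrite out ?eqxx.
Qed.

Lemma supp_outside l i : l \in AX -> l \notin AW -> l 0 i != 0 ->
  ~~ (X <= coordH k i)%VS.
Proof.
move=> lX lW li; apply/negP => Xi.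
have [a [b [ab sl]]] := supp_pair lX lW.
move: lX lW; rewrite !mem_localization => /andP[lA /subvP Xl];
  rewrite lA /= => /negP; apply.
have allX c : l 0 c != 0 -> (X <= coordH k c)%VS.
  move=> lc; have [->//|ci] := eqVneq c i.
  apply/subvP => v vX; rewrite mem_coordH.
  have := Xl v vX; rewrite mem_hypE (bigD1 i) //= (bigD1 c) //=.
  have /eqP -> : v 0 i == 0 by rewrite -mem_coordH (subvP Xi).
  rewrite mulr0 add0r big1 ?addr0 => [|x /andP[xi xc]].
    by rewrite mulf_eq0 (negPf lc).
  have : x \notin supp l; last by rewrite in_supp negbK => /eqP->; rewrite mul0r.
  have : i \in supp l by rewrite in_supp.
  have : c \in supp l by rewrite in_supp.
  rewrite sl !inE => /orP[]/eqP cE /orP[]/eqP iE; move: ci xi xc;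
    rewrite cE iE ?eqxx // => _.
    by move=> /negPf-> /negPf->.
  by move=> /negPf-> /negPf->.
apply/subvP => v vW; rewrite mem_hypE big1 // => c _.
have [->|lc] := eqVneq (l 0 c) 0; first by rewrite mul0r.
suff /eqP-> : v 0 c == 0 by rewrite mulr0.
rewrite -mem_coordH; move: vW; rewrite memvE => /subv_trans; rewrite memvE; apply.
exact: bigcapv_inf (allX c lc) (subvv _).
Qed.

(** Take a point of [X] off the coordinate hyperplanes not containing [X], and set its remaining
    coordinates, which are zero, to 1. The forms concerned do not involve those, by [supp_outside],
    so they still vanish. *)
Lemma generic_weights : exists w : 'I_m -> k,
  [/\ forall i, w i != 0, forall i, (X <= coordH k i)%VS -> w i = 1 &
      forall l, l \in AX -> l \notin AW -> \sum_i l 0 i * w i = 0].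
Proof.
have [|v v' t vX v'X|l|v vX vC] := @avoid_hyperplanes k char0 m (fun v => v \in X)
  [seq delta_mx 0 i | i <- enum 'I_m & ~~ (X <= coordH k i)%VS].
- exact: mem0v.
- by rewrite rpredD ?rpredZ.
- case/mapP => i; rewrite mem_filter => /andP[/subvPn[v vX vi] _] ->; exists v => //.
  by apply: contra vi; rewrite /eval_form -mem_hypE.
pose w i := if (X <= coordH k i)%VS then 1 else v 0 i.
exists w; split=> [i|i Xi|l lX lW].
- rewrite /w; case: ifPn => [_|Xi]; first exact: oner_neq0.
  have : eval_form (delta_mx 0 i) v != 0.
    by apply: vC; apply: map_f; rewrite mem_filter Xi mem_enum.
  by apply: contra => vi; rewrite /eval_form -mem_hypE -[hyp _]/(coordH k i) mem_coordH.
- by rewrite /w Xi.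
have : v \in hyp l by move: lX; rewrite mem_localization => /andP[_ /subvP]; apply.
rewrite mem_hypE => /eqP E; rewrite -[RHS]E; apply: eq_bigr => i _.
have [->|li] := eqVneq (l 0 i) 0; first by rewrite !mul0r.
by rewrite /w (negPf (supp_outside lX lW li)).
Qed.

End LocalStructure.

Theorem theorem3p8 (k : closedFieldType) (char0 : [pchar k] =i pred0)
    (n : nat) (s : 'I_n.+1 -> 'I_n.+1 -> nat)
    (hs : forall i j : 'I_n.+1, (i < j)%N -> (1 <= s i j)%N)
    (A : {fset 'rV[k]_n.+1}) (hA : calH s A)
    (X : {vspace 'rV[k]_n.+1}) (hX : lattice A X) :
  arr_iso (arr_pi (localization A X))
          (arr_prod (arr_pi (localization A (W X))) (graphic k (Gamma A X))) /\
  (free_arr (localization A X) <->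
   free_arr (arr_pi (localization A (W X))) /\ chordal (Gamma A X)).
Proof.
have [hypA _ _] := hA.
have [w [w0 w1 wsum]] := generic_weights char0 X hypA.
set AX := localization A X; set AW := localization A (W X).
have arrX : is_arrangement AX.
  apply: sub_arrangement hypA.1; apply/fsubsetP => l.
  by rewrite mem_localization => /andP[].
have memD l : l \in AX `\` AW -> l \in AX /\ l \notin AW.
  by rewrite inE => /andP[].
have subW := localization_W_sub A X.
have wB i : i \in arr_supp AW -> w i = 1.
  by move=> /arr_suppP[l lW li]; apply: w1; apply: supp_localization_W lW li.
have suppD l : l \in AX `\` AW -> #|supp l| = 2%N.
  move=> /memD[lX lW]; have [i [j [ij ->]]] := supp_pair hypA lX lW.
  by rewrite cards2 ij.
have sumD l : l \in AX `\` AW -> \sum_i l 0 i * w i = 0.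
  by move=> /memD[lX lW]; apply: wsum.
have disjD l i : l \in AX `\` AW -> i \in arr_supp AW -> l 0 i = 0.
  move=> /memD[lX lW] /arr_suppP[l' l'W l'i]; apply/eqP; apply: contraT => li.
  by have := supp_outside hypA lX lW li; rewrite (supp_localization_W l'W l'i).
have edgeG : edge (Gamma A X) = supp_edge (AX `\` AW) by [].
split.
  exact: (localization_iso subW w0 suppD sumD disjD).
split=> [freeA|[freeB chG]].
  split; first exact: (free_restriction char0 arrX subW disjD).
  exact: (free_chordal char0 arrX w0 suppD sumD disjD edgeG).
exact: (chordal_free arrX subW w0 wB suppD sumD disjD edgeG).
Qed.
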